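(* Let $\mu$ be a nonnegative Borel measure on $\mathbb{R}^+$ with $\mu(\mathbb{R}^+)\in(0,\infty)$, let $Z$ be a real-valued $\alpha$-stable L\'evy process with $\alpha\in(0,2)$ that is not a pure drift process, and let $f:\mathbb{R}\to\mathbb{R}$ be locally Lipschitz continuous with $f(x)>0$ for $x>0$ and $\lim_{x\to\infty}f(x)=\infty$. Suppose there is $\phi\in C^1(\mathbb{R}^+;(0,\infty))$ with $\phi'(x)>0$ for all $x\ge0$, $\lim_{x\to\infty}\phi(x)=\infty$, $\lim_{x\to\infty}\phi'(x)=0$, and $$\lim_{x\to\infty}\frac{f(x)}{\phi(x)}=1,\qquad\lim_{|x|\to\infty}\frac{|f(x)|}{\phi(|x|)}=1.$$ Let $X$ be the unique strong (c\`adl\`ag) solution of $$X(t)=X(0)+\int_0^t m(t-s)f(X(s))\,ds+Z(t),\quad t\ge0,\qquad m(t)=\mu([0,t]).$$ If there exists an increasing function $\gamma\in C((0,\infty);(0,\infty))$ such that $$L_f(\gamma):=\lim_{t\to\infty}\frac{\gamma(t)}{\mu(\mathbb{R}^+)\int_0^t f(\gamma(s))\,ds}=0\quad\text{and}\quad\int_0^\infty\gamma(s)^{-\alpha}\,ds<\infty,$$ then $$\limsup_{t\to\infty}\frac{F(|X(t)|)}{\mu(\mathbb{R}^+)t}\le1\quad\text{a.s.},$$ where $F(x)=\int_1^x\frac{du}{f(u)}$ for $x>0$.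
   Context: $\mathbb{R}^+=[0,\infty)$. The underlying filtered probability space is complete with right-continuous filtration, $Z$ is a L\'evy process with respect to it with $Z(0)=0$, and $X(0)$ is a real-valued $\mathcal{F}_0$-measurable initial value. A L\'evy process with characteristic exponent $\Psi$ (i.e. $\mathbb{E}[e^{i\lambda Z(t)}]=e^{-t\Psi(\lambda)}$) is called $\alpha$-stable if $\Psi(k\lambda)=k^\alpha\Psi(\lambda)$ for every $k>0$ and $\lambda\in\mathbb{R}$. $F(0)$ is understood as $\lim_{x\to0^+}F(x)\in[-\infty,0)$. *)

(* Defs.v *)
From HB Require Import structures.
From mathcomp Require Import all_boot all_order all_algebra complex.
From mathcomp Require Import all_classical all_reals all_analysis.

Set Implicit Arguments.
Unset Strict Implicit.
Unset Printing Implicit Defensive.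

Import Order.TTheory GRing.Theory Num.Theory.
Import numFieldNormedType.Exports.

Local Open Scope classical_set_scope.
Local Open Scope ring_scope.

(* Processes are maps [R -> T -> R]; only their values at times [t >= 0]
   matter. *)

(* The usual conditions.  [F 0] contains all subsets of [P]-null sets, hence so
   does every [F t] with [0 <= t]. *)
Record usual_filtration {d : measure_display} {T : measurableType d}
    {R : realType} (P : probability T R) (F : R -> set (set T)) : Prop := {
  filtration_sigma : forall t : R, 0 <= t -> sigma_algebra [set: T] (F t);
  filtration_sub : forall t : R, 0 <= t -> F t `<=` measurable;
  filtration_mono : forall s t : R, 0 <= s -> s <= t -> F s `<=` F t;
  filtration_right_cont : forall s : R, 0 <= s ->
    F s = \bigcap_(t in `]s, +oo[) F t;
  filtration_complete : measure_is_complete P;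
  filtration_null : P.-negligible `<=` F 0 }.

Definition adapted {d : measure_display} {T : measurableType d} {R : realType}
    (F : R -> set (set T)) (X : R -> T -> R) : Prop :=
  forall t : R, 0 <= t -> forall B : set R, measurable B -> F t (X t @^-1` B).

Definition cadlag {R : realType} (x : R -> R) : Prop :=
  (forall t : R, 0 <= t -> x s @[s --> t^'+] --> x t) /\
  (forall t : R, 0 < t -> exists l : R, x s @[s --> t^'-] --> l).

Definition independent_of {d : measure_display} {T : measurableType d}
    {R : realType} (P : probability T R) (G : set (set T)) (Y : T -> R) :
    Prop :=
  forall (A : set T) (B : set R), G A -> measurable B ->
    P (A `&` Y @^-1` B) = (P A * P (Y @^-1` B))%E.

Record levy_process {d : measure_display} {T : measurableType d}
    {R : realType} (P : probability T R) (F : R -> set (set T))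
    (Z : R -> T -> R) : Prop := {
  levy_adapted : adapted F Z;
  levy_start : {ae P, forall w, Z 0 w = 0};
  levy_cadlag : {ae P, forall w, cadlag (Z ^~ w)};
  levy_independent : forall s t : R, 0 <= s -> s <= t ->
    independent_of P (F s) (fun w => Z t w - Z s w);
  levy_stationary : forall s t : R, 0 <= s -> s <= t ->
    forall B : set R, measurable B ->
      P ((fun w => Z t w - Z s w) @^-1` B) = P (Z (t - s) @^-1` B) }.

Definition cexp {R : realType} (z : R[i]) : R[i] :=
  Complex (expR (complex.Re z) * cos (complex.Im z))
          (expR (complex.Re z) * sin (complex.Im z)).

(* [E[exp (i lam Y)]], with the real and imaginary parts integrated
   separately. *)
Definition char_fun {d : measure_display} {T : measurableType d} {R : realType}
    (P : probability T R) (Y : T -> R) (lam : R) : R[i] :=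
  Complex (fine 'E_P[fun w => cos (lam * Y w)])
          (fine 'E_P[fun w => sin (lam * Y w)]).

Definition char_exponent {d : measure_display} {T : measurableType d}
    {R : realType} (P : probability T R) (Z : R -> T -> R) (Psi : R -> R[i]) :
    Prop :=
  forall t lam : R, 0 <= t ->
    char_fun P (Z t) lam = cexp (- (t%:C%C * Psi lam)).

(* [Psi] is unique: two exponents at [lam] give the same function
   [t |-> exp (- t Psi lam)] on [t >= 0]. *)
Definition stable_process {d : measure_display} {T : measurableType d}
    {R : realType} (P : probability T R) (alpha : R) (Z : R -> T -> R) : Prop :=
  exists2 Psi : R -> R[i], char_exponent P Z Psi &
    forall k lam : R, 0 < k -> Psi (k * lam) = (k `^ alpha)%:C%C * Psi lam.

Definition pure_drift {d : measure_display} {T : measurableType d}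
    {R : realType} (P : probability T R) (Z : R -> T -> R) : Prop :=
  exists c : R, forall t : R, 0 <= t -> {ae P, forall w, Z t w = c * t}.

(* For a measure [mu] on the half-line, seen as a measure on [R] carried by
   [[0, +oo[]. *)
Definition cumul {R : realType}
    (mu : {measure set (measurableTypeR R) -> \bar R}) (t : R) : R :=
  fine (mu `[0, t]%classic).

Definition total_mass {R : realType}
    (mu : {measure set (measurableTypeR R) -> \bar R}) : R :=
  fine (mu `[0, +oo[%classic).

Record strong_solution {d : measure_display} {T : measurableType d}
    {R : realType} (P : probability T R) (F : R -> set (set T))
    (mu : {measure set (measurableTypeR R) -> \bar R})
    (f : R -> R) (Z X : R -> T -> R) : Prop := {
  solution_adapted : adapted F X;
  solution_cadlag : {ae P, forall w, cadlag (X ^~ w)};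
  solution_eq : {ae P, forall w, forall t : R, 0 <= t ->
    X t w = X 0 w
      + \int[lebesgue_measure]_(s in `[0, t]) (cumul mu (t - s) * f (X s w))
      + Z t w} }.

(* Derivative relative to [[0, +oo[]: two-sided for [0 < x], one-sided at 0. *)
Definition is_derive_ge0 {R : realType} (g : R -> R) (x l : R) : Prop :=
  (g y - g x) / (y - x) @[y --> within `[0, +oo[%classic x^'] --> l.

Definition C1_ge0 {R : realType} (g dg : R -> R) : Prop :=
  (forall x : R, 0 <= x -> is_derive_ge0 g x (dg x)) /\
  {within `[0, +oo[, continuous dg}.

(* [int_1^x du / f u] for [0 < x], with the orientation convention below 1. *)
Definition Fpos {R : realType} (f : R -> R) (x : R) : R :=
  if 1 <= x then \int[lebesgue_measure]_(u in `[1, x]) (f u)^-1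
  else - \int[lebesgue_measure]_(u in `[x, 1]) (f u)^-1.

(* The function [F] on [[0, +oo[]; its value at 0 is the right limit, which may
   be [-oo]. *)
Definition Fext {R : realType} (f : R -> R) (x : R) : \bar R :=
  if x == 0 then lim ((Fpos f y)%:E @[y --> 0^'+]) else (Fpos f x)%:E.

(* Main.v *)
(* Bounding 1 - E cos(l Z(t)) by a multiple of t l^alpha and averaging over l
   gives the tail estimate P(|Z(t)| >= x) <= C t x^-alpha.  First passage and
   the independence of increments extend it to the running supremum, and
   Borel-Cantelli along t = 2^n, with x = gamma(2^n), shows that almost surely
   |Z(t)| <= 2 gamma(t) for large t.

   The rest is done path by path, with M = mu([0,oo)).  Since f is equivalent
   to the increasing function phi, L_f(gamma) = 0 says that gamma(t) is at most
   e int_0^t phi(gamma) for large t, so that both |X| and gamma are eventually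
   below
     V(t) = |X(0)| + int_0^t [M ((1 + e) phi(|X|) + C) + e phi(gamma)].
   The integrand is then at most K phi(V) with K = M (1 + e) + 2 e.  Comparing V
   with H(t) = V(a) + K int_a^t phi(V), for which (F o H)' <= K (1 + e), bounds
   F(|X(t)|) by K (1 + e) t + O(1); let e tend to 0. *)
Require Import Defs.
From mathcomp Require Import all_boot all_order all_algebra complex.
From mathcomp Require Import all_classical all_reals all_analysis measurable_realfun.
From mathcomp Require Import ring lra.
Import Order.TTheory GRing.Theory Num.Theory.
Import numFieldNormedType.Exports.
Local Open Scope classical_set_scope.
Local Open Scope ring_scope.
Set Implicit Arguments.
Unset Strict Implicit.

(** * Growth of the solution along a path *)

Lemma locally_lipschitz_continuous {R : realType} (f : R -> R) :
  [locally [lipschitz f x | x in [set: R]]] -> continuous f.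
Proof.
move=> hf x; have /(pinfty_ex_gt0) [M M0] := hf (x, x) (conj I I).
rewrite /= /dominated_by /within /= => -[[A B] /= [xA xB] AB].
apply/cvgrPdist_lt => e e0; near=> y.
have /AB/(_ (conj I I)) /= : (A `*` B) (x, y).
  by split => /=; [exact: nbhs_singleton|near: y].
move/le_lt_trans; apply.
rewrite -ltr_pdivlMl//; near: y; apply: cvgr_dist_lt => //.
by rewrite mulr_gt0// invr_gt0.
Unshelve. all: by end_near. Qed.

(** The right end of the mesh cell containing [s] is strictly to the right of [s], so right
    continuity applies as the mesh shrinks. *)
Lemma truncn_mesh {R : realType} (c s : R) : 0 < c -> 0 <= s ->
  s < c * (Num.trunc (s / c)).+1%:R <= s + c.
Proof.
move=> c0 s0.
have /truncn_itv /andP[ls sl] : 0 <= s / c by rewrite divr_ge0// ltW.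
rewrite mulrC -ltr_pdivrMr// sl/= -natr1 mulrDl mul1r lerD2r.
by rewrite -ler_pdivlMr.
Qed.

(* [x] is the limit of the step functions taking on each mesh interval the value
   of [x] at its right end point. *)
Lemma cadlag_measurable {R : realType} (x : R -> R) :
  cadlag x -> measurable_fun (`[0, +oo[%classic : set R) x.
Proof.
move=> [xr _].
pose c (n : nat) : R := n.+1%:R^-1.
have c0 n : 0 < c n by rewrite invr_gt0 ltr0n.
pose h (n : nat) (s : R) : R := c n * (Num.trunc (s / c n)).+1%:R.
have hitv n s : 0 <= s -> s < h n s <= s + c n by exact: truncn_mesh.
apply: (@measurable_fun_cvg _ _ _ _ (fun n s => x (h n s))).
  move=> n _ B mB.
  have -> : `[0, +oo[ `&` (fun s => x (h n s)) @^-1` B =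
    \bigcup_(k in [set k | B (x (c n * k.+1%:R))])
      `[k%:R * c n, k.+1%:R * c n[%classic.
    apply/seteqP; split => s /=; rewrite in_itv/= ?andbT.
      move=> [s0 Bs]; exists (Num.trunc (s / c n)) => //=.
      rewrite in_itv/= -ler_pdivlMr// -ltr_pdivrMr//; apply: truncn_itv.
      by rewrite divr_ge0// ltW.
    move=> [k /= Bk]; rewrite in_itv/= => /andP[ks sk].
    have s0 : 0 <= s by rewrite (le_trans _ ks)// mulr_ge0// ltW.
    split => //; rewrite /h.
    suff -> : Num.trunc (s / c n) = k by [].
    apply/eqP; rewrite truncn_eq ?divr_ge0 ?(ltW (c0 n))//.
    by rewrite ler_pdivlMr// ltr_pdivrMr// ks.
  by apply: bigcup_measurable => k _; exact: measurable_itv.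
move=> s /=; rewrite in_itv/= andbT => s0.
have /cvg_at_rightP := xr s s0; apply; split.
  by move=> n; have /andP[] := hitv n s s0.
apply: (@squeeze_cvgr _ _ _ _ (fun=> s) (fun n => s + c n)).
- by near=> n; have /andP[/ltW -> ->] := hitv n s s0.
- exact: cvg_cst.
- by rewrite -[X in _ --> X]addr0; apply: cvgD; [exact: cvg_cst|exact: cvg_harmonic].
Unshelve. all: by end_near. Qed.

(** Compactness: at each point the two one-sided limits and the value bound [x] nearby by every
    large [B], and a finite cover makes [B] uniform. The guard [0 <= s'] disposes of the left side
    of 0, where nothing is known about [x]. *)
Lemma cadlag_bounded {R : realType} (x : R -> R) (t : R) : cadlag x ->
  exists B, forall s, 0 <= s -> s <= t -> `|x s| <= B.
Proof.
move=> [xr xl].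
have : compact `[0, t]%classic by exact: segment_compact.
move=> /compact_near_coveringP cov.
have H : forall s, `[0, t]%classic s ->
    \forall s' \near s & B \near +oo, 0 <= s' -> `|x s'| <= B.
  move=> s /=; rewrite in_itv/= => /andP[s0 _].
  have lbound : \forall B \near +oo, \forall s' \near s^'-, 0 <= s' -> `|x s'| <= B.
    move: s0; rewrite le_eqVlt => /predU1P[<-|s0].
      near=> B; near=> s' => s'0; exfalso.
      suff : s' < 0 by rewrite ltNge s'0.
      by near: s'; exact: nbhs_left_lt.
    have [l xsl] := xl s s0.
    have : \forall B \near +oo, \forall s' \near s^'-, `|x s'| <= B.
      by apply: cvg_bounded xsl.
    by move=> h; apply: filterS h => B hB; apply: filterS hB => s' ? _.
  have rbound : \forall B \near +oo, \forall s' \near s^'+, `|x s'| <= B.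
    by apply: cvg_bounded (xr s s0).
  have [B [BL [BR Bs]]] : exists B,
      (\forall s' \near s^'-, 0 <= s' -> `|x s'| <= B) /\
      (\forall s' \near s^'+, `|x s'| <= B) /\ `|x s| <= B.
    near (pinfty_nbhs R) => B; exists B; split; first by near: B.
    by split; near: B => //; by apply: nbhs_pinfty_ge; exact: num_real.
  exists ([set s' | 0 <= s' -> `|x s'| <= B], [set B' | B <= B']) => /=.
    split; last by apply: nbhs_pinfty_ge; exact: num_real.
    move: BL BR; rewrite /at_left /at_right /within/= !near_simpl => BL BR.
    near=> s'; have [ss'|s's|<-//] := ltgtP s s'.
      by move=> _; move: ss'; near: s'.
    by move: s's; near: s'.
  by move=> [s' B'] /= [h BB'] s'0; exact: le_trans (h s'0) BB'.
have hB := cov R (pinfty_nbhs R) (fun B s => 0 <= s -> `|x s| <= B) _ H.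
have [B _ {}hB] := pinfty_ex_gt0 (hB _); exists B => s s0 st.
by apply: hB => //=; rewrite in_itv/= s0.
Unshelve. all: by end_near. Qed.

Lemma integrable_inv_segment {R : realType} (f : R -> R) (a b : R) :
  continuous f -> (forall x, 0 < x -> 0 < f x) -> 0 < a ->
  lebesgue_measure.-integrable `[a, b] (EFin \o (fun u => (f u)^-1)).
Proof.
move=> fc f0 a0; apply: continuous_compact_integrable.
  exact: segment_compact.
apply: continuous_in_subspaceT => x; rewrite inE/= in_itv/= => /andP[ax _].
by apply: cvgV; [rewrite gt_eqF// f0// (lt_le_trans a0)|exact: fc].
Qed.

Lemma le_Fpos {R : realType} (f : R -> R) (x y : R) :
  continuous f -> (forall x, 0 < x -> 0 < f x) ->
  0 < x -> x <= y -> Fpos f x <= Fpos f y.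
Proof.
move=> fc f0 x0 xy.
have I0 a b : 0 < a -> 0 <= \int[lebesgue_measure]_(u in `[a, b]) (f u)^-1.
  move=> a0; apply: Rintegral_ge0 => u /=; rewrite in_itv/= => /andP[au _].
  by rewrite invr_ge0 ltW// f0// (lt_le_trans a0).
have I_cat a b c : 0 < a -> a <= b -> b <= c ->
    \int[lebesgue_measure]_(u in `[a, c]) (f u)^-1 =
    \int[lebesgue_measure]_(u in `[a, b]) (f u)^-1 +
    \int[lebesgue_measure]_(u in `[b, c]) (f u)^-1.
  move=> a0 ab bc; have b0 : 0 < b by exact: lt_le_trans ab.
  rewrite -[X in _ = _ + X]Rintegral_itv_obnd_cbnd; last first.
    apply: integrableS (integrable_inv_segment c fc f0 b0) => //.
    by apply: subset_itvr; rewrite bnd_simp.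
  rewrite -(@Rintegral_itvB _ _ (BLeft a)) ?bnd_simp//; last first.
    exact: integrable_inv_segment.
  by rewrite addrC subrK.
rewrite /Fpos; case: ifPn => x1.
  by rewrite (le_trans x1 xy) (I_cat 1 x y)// lerDl I0// (lt_le_trans ltr01).
case: ifPn => y1; first by rewrite (@le_trans _ _ 0)// ?oppr_le0 I0.
rewrite -ltNge in y1.
by rewrite lerN2 (I_cat x y 1)// ?lerDr ?I0// ltW.
Qed.

Lemma is_derive_Rintegral {R : realType} (g : R -> R) (a b x : R) :
  {within `[a, b], continuous g} -> a < x -> x < b ->
  is_derive x 1 (fun y => \int[lebesgue_measure]_(u in `[a, y]) g u) (g x).
Proof.
move=> gc ax xb.
have ig : lebesgue_measure.-integrable `[a, b] (EFin \o g).
  by apply: continuous_compact_integrable; first exact: segment_compact.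
have gx : {for x, continuous g}.
  have /continuous_within_itvP : a < b by exact: lt_trans xb.
  by move=> /(_ _ _ g) [+ _] => /(_ gc) [+ _ _]; apply; rewrite in_itv/= ax.
have [dF dFE] := @continuous_FTC1_closed _ g a x b xb ig ax gx.
by apply: DeriveDef; [exact: dF|rewrite -derive1E; exact: dFE].
Qed.

(** A Gronwall-type argument. [V] obeys only an integral inequality, but its right-hand side [H] is
    differentiable, dominates [V], and satisfies [(F o H)' = K psi(V) / f(H) <= K psi(H) / f(H) <= K
    L]. *)
Lemma Fpos_le_linear {R : realType} (f psi V : R -> R) (a K L t y : R) :
  continuous f -> (forall x, 0 < x -> 0 < f x) ->
  continuous psi -> {homo psi : x y / x <= y} -> (forall x, 0 <= psi x) ->
  {within `[a, t], continuous V} ->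
  0 <= K -> 1 < V a -> a < t ->
  (forall s, a <= s -> s <= t ->
    V s <= V a + K * \int[lebesgue_measure]_(r in `[a, s]) psi (V r)) ->
  (forall x, V a <= x -> psi x <= L * f x) ->
  0 < y -> y <= V t ->
  Fpos f y <= Fpos f (V a) + K * L * (t - a).
Proof.
move=> fc f0 pc pm p0 Vc K0 Va at_ VH pL y0 yV.
have at' : a <= t by exact: ltW.
have pVc : {within `[a, t], continuous (psi \o V)}.
  by move=> r; exact: (cvg_comp _ _ (Vc r) (pc _)).
pose J (s : R) := \int[lebesgue_measure]_(r in `[a, s]) (psi \o V) r.
pose H (s : R) := V a + K * J s.
have J0 s : 0 <= J s by apply: Rintegral_ge0 => r _; exact: p0.
have HV s : V a <= H s by rewrite lerDl mulr_ge0.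
have iV : lebesgue_measure.-integrable `[a, t] (EFin \o (psi \o V)).
  by apply: continuous_compact_integrable; first exact: segment_compact.
have Hc : {within `[a, t], continuous H}.
  move=> s; apply: cvgD; first exact: cvg_cst.
  by apply: cvgMr; exact: parameterized_integral_continuous.
(* [G] is [F] without the case split. As [1 < V a <= H s], only arguments above 1 occur, where [G]
   is differentiable. *)
pose G (x : R) := \int[lebesgue_measure]_(u in `[1, x]) (f u)^-1.
have Gd (x : R) : 1 < x -> is_derive x 1 G (f x)^-1.
  move=> x1; apply: (@is_derive_Rintegral _ (fun u => (f u)^-1) 1 (x + 1)) => //.
    apply: continuous_in_subspaceT => u; rewrite inE/= in_itv/= => /andP[u1 _].
    by apply: cvgV; [rewrite gt_eqF// f0// (lt_le_trans _ u1)|exact: fc].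
  by rewrite ltrDl.
have FG x : 1 <= x -> Fpos f x = G x by rewrite /Fpos => ->.
have VaH s : 1 < H s by exact: lt_le_trans (HV s).
pose D (s : R) := G (H s) - K * L * (s - a).
have Dd (s : R) : s \in `]a, t[ ->
    is_derive s 1 D ((K * psi (V s)) * (f (H s))^-1 - K * L).
  rewrite in_itv/= => /andP[as_ st].
  have dJ : is_derive s 1 J (psi (V s)).
    exact: (@is_derive_Rintegral _ (psi \o V) a t).
  have dH : is_derive s 1 H (K * psi (V s)).
    have := is_deriveD (is_derive_cst (V a) s 1) (is_deriveZ K dJ).
    by rewrite add0r.
  have dG := is_derive1_comp (Gd _ (VaH s)) dH.
  have dL : is_derive s 1 (fun s => K * L * (s - a)) (K * L).
    have := is_deriveZ (K * L) (is_deriveB (is_derive_id s 1) (is_derive_cst a s 1)).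
    by rewrite subr0 /GRing.scale/= mulr1.
  by rewrite mulrC; exact: is_deriveB dG dL.
have Dc : {within `[a, t], continuous D}.
  move=> s; apply: cvgB.
    have Gc : {for H s, continuous G}.
      apply: differentiable_continuous; apply/derivable1_diffP.
      by have [] := Gd _ (VaH s).
    exact: (cvg_comp _ _ (Hc s) Gc).
  apply: cvgMr; apply: cvgB; last exact: cvg_cst.
  have idc : continuous (id : R -> R) by move=> ?.
  exact: (continuous_subspaceT idc).
have Dle : D t <= D a.
  apply: (@ler0_derive1_le_cc _ D a t) => //; rewrite ?in_itv/= ?lexx ?at'//.
    by move=> s /Dd[].
  move=> s sI; have [_] := Dd s sI; rewrite derive1E => ->.
  rewrite subr_le0 -mulrA ler_wpM2l// ler_pdivrMr ?f0// ?(lt_trans ltr01)//.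
  apply: le_trans (pL _ (HV s)); apply: pm.
  by move: sI; rewrite in_itv/= => /andP[/ltW as_ /ltW st]; exact: VH.
have Ha : H a = V a by rewrite /H /J set_itv1 Rintegral_set1 mulr0 addr0.
have VtH : V t <= H t by exact: VH.
rewrite (le_trans (le_Fpos fc f0 y0 (le_trans yV VtH)))//.
move: Dle; rewrite /D Ha subrr mulr0 subr0 lerBlDr => Dle.
by rewrite (FG _ (ltW (VaH t))) (FG _ (ltW Va)).
Qed.

Lemma bounded_measurable_integrable_segment {R : realType} (h : R -> R)
    (a b B : R) :
  measurable_fun (`[a, b]%classic : set R) h ->
  (forall s, a <= s -> s <= b -> `|h s| <= B) ->
  lebesgue_measure.-integrable `[a, b] (EFin \o h).
Proof.
move=> mh hB; apply: measurable_bounded_integrable => //.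
  by apply: compact_finite_measure; exact: segment_compact.
exists B; split; rewrite ?num_real// => r Br s /=.
rewrite in_itv/= => /andP[as_ sb].
by apply: le_trans (hB _ as_ sb) (ltW Br).
Qed.

(** * Comparison with an integral majorant, for a single deterministic path *)

Section path.
Context {R : realType}.
Variables (M : R) (m f psi g x z : R -> R) (T0 : R).
Hypotheses (M0 : 0 < M) (m0 : forall s, 0 <= m s) (mM : forall s, m s <= M)
  (m_nd : {homo m : s t / s <= t})
  (fc : continuous f) (fpos : forall y, 0 < y -> 0 < f y)
  (psic : continuous psi) (psi_nd : {homo psi : s t / s <= t})
  (psi_pos : forall y, 0 < psi y) (psiy : psi y @[y --> +oo] --> +oo)
  (f_le_psi : forall e, 0 < e -> exists2 C, 0 <= C &
    forall y, `|f y| <= (1 + e) * psi `|y| + C)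
  (psi_le_f : forall e, 0 < e -> \forall y \near +oo, psi y <= (1 + e) * f y)
  (g_nd : {homo g : s t / s <= t}) (g0 : forall s, 0 <= g s)
  (g_small : forall e, 0 < e -> \forall t \near +oo,
    g t <= e * \int[lebesgue_measure]_(s in `[0, t]) psi (g s))
  (xcad : cadlag x)
  (xE : forall t, 0 <= t -> x t = x 0
    + \int[lebesgue_measure]_(s in `[0, t]) (m (t - s) * f (x s)) + z t)
  (zg : forall t, T0 <= t -> `|z t| <= 2 * g t).

Let ig t : lebesgue_measure.-integrable `[0, t] (EFin \o (psi \o g)).
Proof.
apply: (@bounded_measurable_integrable_segment _ _ _ _ (psi (g t))) => [|s _ st].
  apply: nondecreasing_measurable => // s s' ss'.
  by apply: psi_nd; exact: g_nd.
by rewrite /= ger0_norm ?(ltW (psi_pos _))//; apply: psi_nd; exact: g_nd.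
Qed.

Let mx t : measurable_fun (`[0, t]%classic : set R) x.
Proof.
apply: measurable_funS (cadlag_measurable xcad) => //.
by apply: subset_itvl; rewrite bnd_simp.
Qed.

Let mpx t : measurable_fun (`[0, t]%classic : set R) (fun s => psi `|x s|).
Proof.
apply: (@measurableT_comp _ _ _ _ _ _ psi).
  exact: continuous_measurable_fun.
exact: measurableT_comp.
Qed.

(** In the slope, [M * (1 + e)] comes from the kernel and [f], one [e] absorbs the additive constant
    of the bound on [f], the other carries the noise, and the last factor [1 + e] is the price of
    replacing [psi] by [f]. Taking all [y] in []0, |x t|]] avoids the value of [F] at 0. *)
Lemma path_Fpos_le e : 0 < e -> exists a C, 0 <= a /\
  forall t y, a < t -> 0 < y -> y <= `|x t| ->
  Fpos f y <= C + (M * (1 + e) + e + e) * (1 + e) * (t - a).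
Proof.
move=> e0.
have [C C0 fC] := f_le_psi e0.
(* [h1] dominates [|m (t - s) * f (x s)|] for every [t]. This removes the convolution and leaves an
   integrand independent of [t]. *)
pose h1 (s : R) : R := M * ((1 + e) * psi `|x s| + C).
pose h s := h1 s + e * psi (g s).
pose V t := `|x 0| + \int[lebesgue_measure]_(s in `[0, t]) h s.
have h1_ge0 s : 0 <= h1 s.
  by rewrite mulr_ge0 ?(ltW M0)// addr_ge0// mulr_ge0 ?ltW// addr_gt0.
have h_ge0 s : 0 <= h s by rewrite addr_ge0// mulr_ge0// ltW.
have ih1 t : lebesgue_measure.-integrable `[0, t] (EFin \o h1).
  have [B xB] := cadlag_bounded t xcad.
  apply: (@bounded_measurable_integrable_segment _ _ _ _
    (M * ((1 + e) * psi B + C))) => [|s s0 st].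
    by apply: measurable_funM => //; apply: measurable_funD => //; apply: measurable_funM.
  rewrite ger0_norm//; apply: ler_wpM2l; first exact: ltW.
  by rewrite lerD2r; apply: ler_wpM2l; [rewrite ltW// addr_gt0|apply: psi_nd; exact: xB].
have ieg t : lebesgue_measure.-integrable `[0, t] (EFin \o (fun s => e * psi (g s))).
  exact: integrableZl (ig t).
have ih t : lebesgue_measure.-integrable `[0, t] (EFin \o h).
  exact: integrableD (ih1 t) (ieg t).
have imf t : lebesgue_measure.-integrable `[0, t] (EFin \o (fun s => m (t - s) * f (x s))).
  apply: le_integrable (ih1 t) => //.
    apply/measurable_EFinP; apply: measurable_funM.
      apply: nonincreasing_measurable => // s s' ss'.
      by apply: m_nd; rewrite lerD2l lerN2.
    by apply: (@measurableT_comp _ _ _ _ _ _ f); [exact: continuous_measurable_fun|exact: mx].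
  move=> s _ /=; rewrite lee_fin (ger0_norm (h1_ge0 s)) normrM ger0_norm//.
  by rewrite ler_pM.
have VE t : V t = `|x 0| + (\int[lebesgue_measure]_(s in `[0, t]) h1 s
    + e * \int[lebesgue_measure]_(s in `[0, t]) psi (g s)).
  rewrite /V RintegralD//; congr (_ + (_ + _)).
  by rewrite RintegralZl//; exact: ig.
(* The noise is at most [2 * g t], so the smallness of [g] is used with [e / 2]. *)
have xV : \forall t \near +oo, `|x t| <= V t /\ g t <= V t.
  have e20 : 0 < e / 2 by rewrite divr_gt0.
  near=> t.
  have t0 : 0 <= t by near: t; apply: nbhs_pinfty_ge; exact: num_real.
  have gt : 2 * g t <= e * \int[lebesgue_measure]_(s in `[0, t]) psi (g s).
    rewrite -ler_pdivlMl// mulrA (mulrC _ e); near: t; exact: g_small.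
  have ih1_ge0 : 0 <= \int[lebesgue_measure]_(s in `[0, t]) h1 s.
    exact: Rintegral_ge0.
  split; last first.
    have gt3 : g t <= 2 * g t by apply: ler_peMl => //; rewrite ler1n.
    by rewrite VE addrA (le_trans gt3)// (le_trans gt)// lerDr addr_ge0.
  rewrite xE// VE addrA; apply: le_trans (ler_normD _ _) _; apply: lerD.
    apply: le_trans (ler_normD _ _) _; rewrite lerD2l.
    apply: (le_trans (le_normr_Rintegral _ (imf t))) => //.
    apply: le_Rintegral => //; first exact: integrable_norm.
    by move=> s _; rewrite normrM ger0_norm// ler_pM//.
  apply: le_trans gt; apply: zg; near: t.
  by apply: nbhs_pinfty_ge; exact: num_real.
(* Since [psi (g s) >= psi 0 > 0], [V] grows at least linearly; this is what makes it tend to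
   infinity. *)
have VtE t : 0 <= t -> e * psi 0 * t <= V t.
  move=> t0; rewrite VE addrA ler_wpDl//.
    by rewrite addr_ge0//; exact: Rintegral_ge0.
  rewrite -mulrA; apply: ler_wpM2l; first exact: ltW.
  have -> : psi 0 * t = \int[lebesgue_measure]_(s in `[0, t]) psi 0.
    rewrite Rintegral_cst//= lebesgue_measure_itv/= lte_fin.
    by case: ltgtP t0 => //= [_|<-]; rewrite ?mulr0// subr0.
  apply: le_Rintegral => //; last by move=> s _; exact: psi_nd.
  apply: (@bounded_measurable_integrable_segment _ _ _ _ (psi 0)) => // s _ _.
  by rewrite ger0_norm ?(ltW (psi_pos _)).
have Vlarge (A : R) : \forall t \near +oo, A <= V t.
  have ep : 0 < e * psi 0 by rewrite mulr_gt0.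
  near=> t; apply: le_trans (VtE _ _).
    by rewrite -ler_pdivrMl//; near: t; apply: nbhs_pinfty_ge; exact: num_real.
  by near: t; apply: nbhs_pinfty_ge; exact: num_real.
have [a [a0 [Va1 [axV [aC apsi]]]]] : exists a, 0 <= a /\ 1 < V a /\
    (forall t, a <= t -> `|x t| <= V t /\ g t <= V t) /\
    (forall t, a <= t -> M * C <= e * psi (V t)) /\
    (forall y, V a <= y -> psi y <= (1 + e) * f y).
  have [A1 [_ hA1]] := psi_le_f e0.
  have [A2 [_ hA2]] : \forall y \near +oo, e^-1 * (M * C) <= psi y.
    by move/cvgryPge : psiy; apply; exact: num_real.
  (* The margins [+ 1] and the level 2 give the strict inequalities [A1 < V t], [A2 < V t] and
     [1 < V t]; taking [Num.max b 0 + 1] makes [a] both nonnegative and larger than [b]. *)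
  have [b [_ hb]] := filterI xV (filterI (Vlarge (A1 + 1))
    (filterI (Vlarge (A2 + 1)) (Vlarge 2))).
  have bb : b < Num.max b 0 + 1 by rewrite ltr_pwDr// le_max lexx.
  exists (Num.max b 0 + 1); split; first by rewrite addr_ge0// le_max lexx orbT.
  split; first by have [_ [_ [_]]] := hb _ bb; apply: lt_le_trans; rewrite ltr1n.
  split; first by move=> t /(lt_le_trans bb) /hb[].
  split.
    move=> t /(lt_le_trans bb) /hb[_ [_ [At _]]].
    by rewrite -ler_pdivrMl//; apply: hA2; apply: lt_le_trans At; rewrite ltrDl.
  move=> y Vy; apply: hA1; apply: lt_le_trans Vy.
  by have [_ [Ab _]] := hb _ bb; apply: lt_le_trans Ab; rewrite ltrDl.
exists a, (Fpos f (V a)); split => // t y at_ y0 yx.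
have Vc s : {within `[a, s], continuous V}.
  have [sa|as_] := ltP s a; first by rewrite set_itv_ge ?bnd_simp -?ltNge//; exact: continuous_subspace0.
  apply: (@continuous_subspaceW _ _ _ `[0, s]).
    by apply: subset_itvr; rewrite bnd_simp.
  move=> r; apply: cvgD; first exact: cvg_cst.
  by apply: parameterized_integral_continuous => //; exact: le_trans as_.
(* Term by term: [psi |x|] and [psi g] are at most [psi V] by monotonicity, and [M * C <= e * psi V]
   by the choice of [a]. *)
have hK s : a <= s -> h s <= (M * (1 + e) + e + e) * psi (V s).
  move=> as_; have [xVs gVs] := axV _ as_.
  rewrite /h /h1 mulrDr mulrA [leRHS]mulrDl [X in _ <= X + _]mulrDl -!addrA lerD//.
    apply: ler_wpM2l; first by rewrite ltW// mulr_gt0// addr_gt0.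
    exact: psi_nd.
  rewrite lerD//; first exact: aC.
  by apply: ler_wpM2l; [exact: ltW|exact: psi_nd].
have K0 : 0 <= M * (1 + e) + e + e.
  by rewrite ltW// addr_gt0// addr_gt0// mulr_gt0// addr_gt0.
apply: (Fpos_le_linear fc fpos psic psi_nd (fun y => ltW (psi_pos y)) (Vc t) K0 Va1 at_ _ apsi y0).
  move=> s as_ st.
  have ipV : lebesgue_measure.-integrable `[a, s] (EFin \o (psi \o V)).
    have pVc : {within `[a, s], continuous (psi \o V)}.
      by move=> r; exact: (cvg_comp _ _ (Vc s r) (@psic _)).
    by apply: continuous_compact_integrable; first exact: segment_compact.
  have sub : `]a, s] `<=` `[a, s] by apply: subset_itvr; rewrite bnd_simp.
  have ipV' : lebesgue_measure.-integrable `]a, s] (EFin \o (psi \o V)).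
    exact: integrableS ipV.
  (* [V s - V a] is the integral of [h] over []a, s]], to which [hK] applies pointwise. *)
  rewrite -lerBlDl {1}/V addrAC /V opprD addrA subrr sub0r addrC.
  rewrite Rintegral_itvB ?bnd_simp//.
  rewrite -Rintegral_itv_obnd_cbnd//.
  rewrite -RintegralZl//.
  apply: le_Rintegral => //.
  - by apply: integrableS (ih s) => //; apply: subset_itvr; rewrite bnd_simp.
  - exact: integrableZl ipV'.
  - by move=> r /=; rewrite in_itv/= => /andP[/ltW ar _]; exact: hK.
by have [xVt _] := axV _ (ltW at_); apply: le_trans xVt.
Unshelve. all: by end_near. Qed.
Lemma path_Fpos_le_linear e : 0 < e -> \forall t \near +oo,
  forall y, 0 < y -> y <= `|x t| -> Fpos f y <= (1 + e) * (M * t).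
Proof.
move=> e0; have M34 : 0 < 3 * M + 4 by rewrite addr_gt0// mulr_gt0.
(* For [d <= 1] the slope [(M (1 + d) + 2 d) (1 + d)] is at most [M + d (3 M + 4)], hence at most
   [M (1 + e / 2)]. The other [e / 2] absorbs the constant [C] for large [t]. *)
pose d := Num.min 1 (e / 2 * M / (3 * M + 4)).
have d0 : 0 < d by rewrite lt_min ltr01/= divr_gt0// mulr_gt0// divr_gt0.
have d1 : d <= 1 by rewrite ge_min lexx.
have dM : d * (3 * M + 4) <= e / 2 * M by rewrite -ler_pdivlMr// ge_min lexx orbT.
have [a [C [a0 aC]]] := path_Fpos_le d0.
set K := (M * (1 + d) + d + d) * (1 + d) in aC.
have K0 : 0 <= K by rewrite !(mulr_ge0, addr_ge0)// ltW.
have KM : K <= M + e / 2 * M.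
  apply: le_trans (_ : M + d * (3 * M + 4) <= _); last by rewrite lerD2l.
  have dd : d * d <= d by rewrite ler_piMr// ltW.
  have : M * (d * d) <= M * d by rewrite ler_wpM2l// ltW.
  by rewrite /K; lra.
have eM : 0 < e / 2 * M by rewrite mulr_gt0// divr_gt0.
have split_e t : e / 2 * M * t + (M + e / 2 * M) * t = (1 + e) * (M * t) by field.
near=> t => y y0 yx.
have at_ : a < t by near: t; apply: nbhs_pinfty_gt; exact: num_real.
have Ct : C <= e / 2 * M * t.
  by rewrite -ler_pdivrMl//; near: t; apply: nbhs_pinfty_ge; exact: num_real.
apply: le_trans (aC _ _ at_ y0 yx) _.
have : K * (t - a) <= (M + e / 2 * M) * t.
  apply: (@le_trans _ _ (K * t)).
    by rewrite ler_wpM2l// gerDl oppr_le0.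
  by rewrite ler_wpM2r// (le_trans a0)// ltW.
by move=> /(lerD Ct); rewrite split_e.
Unshelve. all: by end_near. Qed.

End path.

(** At [x = 0] the right limit of a nondecreasing function is its infimum over []0, y]]; this covers
    the value [-oo] as well. *)
Lemma Fext_le_Fpos {R : realType} (f : R -> R) (x y : R) :
  continuous f -> (forall x, 0 < x -> 0 < f x) ->
  0 <= x -> 0 < y -> x <= y -> (Fext f x <= (Fpos f y)%:E)%E.
Proof.
move=> fc f0 x0 y0 xy; rewrite /Fext; case: ifPn => [_|xn0]; last first.
  by rewrite lee_fin le_Fpos// lt_neqAle eq_sym xn0.
have nd : {in Interval (BRight 0) (BRight y) &,
    nondecreasing_fun (fun y => (Fpos f y)%:E)}.
  move=> u v; rewrite !in_itv/= => /andP[u0 _] /andP[v0 _] uv.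
  by rewrite lee_fin le_Fpos.
have y0' : (BRight 0 < BRight y)%O by rewrite bnd_simp.
rewrite (cvg_lim _ (nondecreasing_at_right_cvge _ y0' nd))//.
by apply: ereal_inf_lbound; exists y => //=; rewrite in_itv/= y0 lexx.
Qed.

Lemma limf_esup_le {R : realType} (u : R -> \bar R)
    (F : set_system R) (l : R) :
  (forall e, 0 < e -> \forall t \near F, (u t <= (l + e)%:E)%E) ->
  (limf_esup u F <= l%:E)%E.
Proof.
move=> ul; apply/lee_addgt0Pr => e e0; rewrite limf_esupE.
apply: le_trans (_ : ereal_sup (u @` [set t | (u t <= (l + e)%:E)%E]) <= _)%E.
  by apply: ereal_inf_lbound; eexists; [exact: ul e0|].
by apply: ge_ereal_sup => _ [t /= ut <-].
Qed.

(** * Regularity of [phi] and its extension to the whole line *)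

Section C1_half_line.
Context {R : realType}.
Variables (phi dphi : R -> R).
Hypothesis (phi_C1 : C1_ge0 phi dphi).

Lemma C1_ge0_derivable (x : R) : 0 < x -> is_derive x 1 phi (dphi x).
Proof.
move=> x0; have [/(_ _ (ltW x0)) + _] := phi_C1.
rewrite /is_derive_ge0 => dphix.
have : h^-1 *: (phi (h *: (1 : R) + x) - phi x) @[h --> 0^'] --> dphi x.
  apply/cvgrPdist_lt => e e0.
  have /cvgrPdist_lt/(_ _ e0) H := dphix.
  rewrite /within/= /dnbhs /within/= in H.
  have [d /= d0 dP] := (nbhs_ballP _ _).1 H.
  near=> h.
  have h0 : h != 0 by near: h; exact: nbhs_dnbhs_neq.
  (* The bound [|h| < x] keeps [h + x] in the half-line, so the relative limit is the ordinary
     one. *)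
  have hd : `|h| < Num.min d x by near: h; apply: dnbhs0_lt; rewrite lt_min d0.
  move: hd; rewrite lt_min => /andP[hd hx].
  have := dP (h + x).
  rewrite /ball/= opprD addrCA subrr addr0 normrN => /(_ hd).
  have -> : h *: 1 + x = h + x by rewrite /GRing.scale/= mulr1.
  rewrite addrK mulrC; apply.
    by rewrite -subr_eq0 addrK.
  rewrite in_itv/= andbT -lerBlDr sub0r.
  by move: hx => /ltW; rewrite ler_norml => /andP[].
by move=> dE; apply: DeriveDef; [apply/cvg_ex; exists (dphi x)|apply: cvg_lim].
Unshelve. all: by end_near. Qed.

(** The difference quotient converges and [y - x] tends to 0, so their product [phi y - phi x] tends
    to 0. *)
Lemma C1_ge0_continuous (x : R) : 0 <= x ->
  phi y @[y --> within `[0, +oo[%classic (nbhs x)] --> phi x.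
Proof.
move=> x0; have [/(_ _ x0) + _] := phi_C1.
rewrite /is_derive_ge0 => dphix.
have id0 : y - x @[y --> within `[0, +oo[%classic x^'] --> (0 : R).
  apply/cvgrPdist_lt => e e0; near=> y; rewrite sub0r normrN.
  near: y; apply: cvg_within; apply: nbhs_dnbhs.
  under eq_fun do rewrite distrC.
  exact: nbhsx_ballx.
have := cvgM dphix id0; rewrite mulr0 => H.
apply/cvgrPdist_lt => e e0.
have FF : Filter (within `[0, +oo[%classic x^') by exact: within_filter.
have H1 := (@cvgrPdist_lt _ _ _ _ FF _ _).1 (H FF) _ e0.
rewrite /within/= /dnbhs /within/= in H1.
have [d /= d0 dP] := (nbhs_ballP _ _).1 H1.
apply/nbhs_ballP; exists d => //= y xy y0.
have [->|yx] := eqVneq y x; first by rewrite subrr normr0.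
by have := dP _ xy yx y0; rewrite sub0r normrN divfK ?subr_eq0// distrC.
Unshelve. all: by end_near. Qed.

Lemma C1_ge0_max_continuous : continuous (fun x : R => phi (Num.max 0 x)).
Proof.
move=> x; apply/cvgrPdist_lt => e e0.
have m0 : 0 <= Num.max 0 x by rewrite le_max lexx.
have /cvgrPdist_lt/(_ _ e0) H := C1_ge0_continuous m0.
rewrite /within/= in H.
have mc : (fun x : R => Num.max 0 x) y @[y --> x] --> Num.max 0 x.
  by apply: continuous_max; [exact: cvg_cst|exact: cvg_id].
near=> y.
have : `[0, +oo[%classic (Num.max 0 y) ->
  `|phi (Num.max 0 x) - phi (Num.max 0 y)| < e by near: y; exact: mc _ H.
by apply; rewrite /= in_itv/= andbT le_max lexx.
Unshelve. all: by end_near. Qed.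

Lemma C1_ge0_nondecreasing : (forall x, 0 <= x -> 0 <= dphi x) ->
  {in `[0, +oo[ &, {homo phi : x y / x <= y}}.
Proof.
move=> dphi0 x y; rewrite !in_itv/= !andbT => x0 y0 xy.
apply: (@ger0_derive1_le_cc _ phi x y) => //; rewrite ?in_itv/= ?lexx ?xy//.
- move=> z; rewrite in_itv/= => /andP[xz _].
  by have [] := C1_ge0_derivable (le_lt_trans x0 xz).
- move=> z; rewrite in_itv/= => /andP[xz _].
  have z0 := le_lt_trans x0 xz.
  by have [_] := C1_ge0_derivable z0; rewrite derive1E => ->; exact/dphi0/ltW.
- have sub : (`[x, y] `<=` (`[0, +oo[ : set R))%classic.
    by apply: subset_itv; rewrite bnd_simp.
  apply: continuous_subspaceW sub _.
  apply/subspace_continuousP => z /=; rewrite in_itv/= andbT => z0.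
  exact: C1_ge0_continuous.
Qed.

End C1_half_line.

(** * Inequalities drawn from the equivalence of [f] and [phi] at infinity *)

Section asymptotic_equivalence.
Context {R : realType}.
Variables (f psi : R -> R).
Hypotheses (fc : continuous f) (psi_pos : forall y, 0 < psi y).

(** The two limits give the bound outside some [[-N, N]]; on that segment the maximum of [|f|]
    serves as [C]. *)
Lemma norm_le_of_equiv (e : R) :
  `|f y| / psi `|y| @[y --> +oo] --> (1 : R) ->
  `|f y| / psi `|y| @[y --> -oo] --> (1 : R) ->
  0 < e -> exists2 C, 0 <= C & forall y, `|f y| <= (1 + e) * psi `|y| + C.
Proof.
move=> fp fn e0.
have key y : `|1 - `|f y| / psi `|y| | < e -> `|f y| <= (1 + e) * psi `|y|.
  rewrite ltr_distlC => /andP[_ /ltW].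
  by rewrite ler_pdivrMr.
have [A [_ hA]] := (cvgrPdist_lt _ _).1 fp _ e0.
have [B [_ hB]] := (cvgrPdist_lt _ _).1 fn _ e0.
pose N := `|A| + `|B|.
have N0 : 0 <= N by rewrite addr_ge0.
have NN : - N <= N by rewrite (@le_trans _ _ 0)// oppr_le0.
have nfc : continuous (fun y : R => `|f y|) by move=> y; exact: cvg_norm (@fc y).
have [c _ hc] := EVT_max NN (continuous_subspaceT nfc).
exists `|f c| => // y.
have psi1 : 0 <= (1 + e) * psi `|y| by rewrite mulr_ge0 ?addr_ge0// ltW.
have [yN|yN] := ltP y (- N).
  rewrite ler_wpDr//; apply: key; apply: hB; apply: lt_le_trans yN _.
  by rewrite lerNl (le_trans (ler_norm _))// normrN /N lerDr.
have [Ny|Ny] := ltP N y.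
  rewrite ler_wpDr//; apply: key; apply: hA; apply: le_lt_trans Ny.
  by rewrite (le_trans (ler_norm _))// /N lerDl.
by rewrite ler_wpDl// hc// in_itv/= yN.
Qed.

Lemma le_of_equiv (e : R) :
  f y / psi y @[y --> +oo] --> (1 : R) -> 0 < e ->
  \forall y \near +oo, psi y <= (1 + e) * f y.
Proof.
move=> fp e0; have e1 : 0 < 1 + e by rewrite addr_gt0.
(* The tolerance is chosen so that [1 - e / (1 + e) = 1 / (1 + e)], which then bounds [f / psi] from
   below. *)
have d0 : 0 < e / (1 + e) by rewrite divr_gt0.
have eE : 1 - e / (1 + e) = (1 + e)^-1 by field; rewrite gt_eqF.
have H := (cvgrPdist_lt _ _).1 fp _ d0.
near=> y; have : `|1 - f y / psi y| < e / (1 + e) by near: y; exact: H.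
rewrite ltr_distlC eE => /andP[/ltW + _].
by rewrite ler_pdivlMr// ler_pdivrMl.
Unshelve. all: by end_near. Qed.

End asymptotic_equivalence.

(** * Using the condition [L_f(gamma) = 0] *)

Section small_gamma.
Context {R : realType}.
Variables (f psi g : R -> R) (M : R).
Hypotheses (M0 : 0 < M) (fc : continuous f) (fpos : forall y, 0 < y -> 0 < f y)
  (psi_nd : {homo psi : s t / s <= t})
  (psi_pos : forall y, 0 < psi y)
  (f_le_psi : exists2 C, 0 <= C & forall y, `|f y| <= (1 + 1) * psi `|y| + C)
  (g_nd : {homo g : s t / s <= t}) (g_ge0 : forall s, 0 <= g s)
  (g_gt0 : forall s, 0 < s -> 0 < g s)
  (gL : g t / (M * \int[lebesgue_measure]_(s in `]0, t]) f (g s))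
    @[t --> +oo] --> (0 : R)).

(** The ratio in [L_f] has [f (g s)] in its denominator. Bounding [f] by a multiple of [psi] on the
    half-line turns the limit into an inequality against the integral of [psi (g s)]. *)
Lemma le_integral_of_L0 (e : R) : 0 < e -> \forall t \near +oo,
  g t <= e * \int[lebesgue_measure]_(s in `[0, t]) psi (g s).
Proof.
move=> e0; have [C C0 fC] := f_le_psi.
(* For [y >= 0] one has [psi 0 <= psi y], so the additive constant satisfies
   [C <= (C / psi 0) * psi y]. *)
pose C1 := (1 + 1) + C / psi 0.
have C10 : 0 < C1 by rewrite ltr_pwDl// divr_ge0// ltW.
have fC1 y : 0 <= y -> `|f y| <= C1 * psi y.
  move=> y0; apply: le_trans (fC y) _.
  rewrite ger0_norm// [leRHS]mulrDl lerD2l mulrAC ler_pdivlMr//.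
  by rewrite ler_wpM2l// psi_nd.
have ipsi t : lebesgue_measure.-integrable `[0, t] (EFin \o (psi \o g)).
  apply: (@bounded_measurable_integrable_segment _ _ _ _ (psi (g t))) => [|s _ st].
    apply: nondecreasing_measurable => // s s' ss'.
    by apply: psi_nd; exact: g_nd.
  by rewrite /= ger0_norm ?(ltW (psi_pos _))//; apply: psi_nd; exact: g_nd.
have iCpsi t : lebesgue_measure.-integrable `]0, t] (EFin \o (fun s => C1 * psi (g s))).
  have H : lebesgue_measure.-integrable `]0, t] (EFin \o (psi \o g)).
    by apply: integrableS (ipsi t) => //; apply: subset_itvr; rewrite bnd_simp.
  exact: integrableZl H.
have ifg t : lebesgue_measure.-integrable `]0, t] (EFin \o (f \o g)).
  apply: le_integrable (iCpsi t) => //.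
    apply/measurable_EFinP; apply: (@measurableT_comp _ _ _ _ _ _ f).
      exact: continuous_measurable_fun.
    exact: nondecreasing_measurable.
  move=> s _ /=; rewrite lee_fin [leRHS]ger0_norm; first exact: fC1.
  by rewrite mulr_ge0// ltW.
have Dle t : \int[lebesgue_measure]_(s in `]0, t]) f (g s) <=
    C1 * \int[lebesgue_measure]_(s in `[0, t]) psi (g s).
  rewrite -Rintegral_itv_obnd_cbnd; last first.
    by apply: integrableS (ipsi t) => //; apply: subset_itvr; rewrite bnd_simp.
  rewrite -RintegralZl//; last first.
    by apply: integrableS (ipsi t) => //; apply: subset_itvr; rewrite bnd_simp.
  apply: le_Rintegral => // s _; exact: le_trans (ler_norm _) (fC1 _ (g_ge0 s)).
have fg0 s : 0 < s -> 0 <= f (g s) by move=> s0; rewrite ltW// fpos// g_gt0.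
(* A small quotient bounds its numerator only if the denominator is positive, since division by 0
   returns 0. On []1, t]] the integrand is at least the minimum of [f] over [[g 1, g t]], which is
   positive. *)
have Dgt0 t : 1 < t -> 0 < \int[lebesgue_measure]_(s in `]0, t]) f (g s).
  move=> t1.
  have [c cI hc] := @EVT_min R f (g 1) (g t) (g_nd (ltW t1)) (continuous_subspaceT fc).
  have fc0 : 0 < f c.
    by apply: fpos; apply: lt_le_trans (g_gt0 ltr01) _; move: cI; rewrite in_itv/= => /andP[].
  have i1t : lebesgue_measure.-integrable `]1, t] (EFin \o (f \o g)).
    by apply: integrableS (ifg t) => //; apply: subset_itvr; rewrite bnd_simp.
  apply: (@lt_le_trans _ _ (f c * (t - 1))); first by rewrite mulr_gt0// subr_gt0.
  apply: (@le_trans _ _ (\int[lebesgue_measure]_(s in `]1, t]) f (g s))); last first.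
    rewrite -(@Rintegral_itvB _ _ (BRight 0) (BRight t) 1 (ifg t)) ?bnd_simp//; last exact: ltW.
    by rewrite gerBl; apply: Rintegral_ge0 => s /=; rewrite in_itv/= => /andP[/fg0].
  have -> : f c * (t - 1) = \int[lebesgue_measure]_(s in `]1, t]) f c.
    by rewrite Rintegral_cst//= lebesgue_measure_itv/= lte_fin t1.
  apply: le_Rintegral => //.
    apply: integrableS (@bounded_measurable_integrable_segment _ (cst (f c)) 1 t (f c) _ _) => //.
      by apply: subset_itvr; rewrite bnd_simp.
    by move=> s _ _; rewrite ger0_norm// ltW.
  move=> s /=; rewrite in_itv/= => /andP[s1 st]; apply: hc.
  by rewrite in_itv/= !g_nd// ltW.
(* This tolerance cancels the factor [M] of the denominator and the [C1] of [Dle]. *)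
have d0 : 0 < e / (M * C1) by rewrite divr_gt0// mulr_gt0.
have H := (cvgrPdist_lt _ _).1 gL _ d0.
near=> t.
have t1 : 1 < t by near: t; apply: nbhs_pinfty_gt; exact: num_real.
have MD : 0 < M * \int[lebesgue_measure]_(s in `]0, t]) f (g s) by rewrite mulr_gt0// Dgt0.
have : `|0 - g t / (M * \int[lebesgue_measure]_(s in `]0, t]) f (g s))| < e / (M * C1).
  by near: t; exact: H.
rewrite sub0r normrN ger0_norm; last by rewrite divr_ge0// ltW.
rewrite ltr_pdivrMr// => /ltW /le_trans; apply.
rewrite mulrA invfM mulrA -(mulrA (e / M)) (mulrC C1^-1) mulrA divfK ?gt_eqF//.
rewrite -mulrA ler_wpM2l ?(ltW e0)// ler_pdivrMl//.
Unshelve. all: by end_near. Qed.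

End small_gamma.

(** * Bounds and monotonicity of the kernel [m] *)

Section cumulative_mass.
Context {R : realType}.
Variable mu : {measure set (measurableTypeR R) -> \bar R}.
Hypothesis mu_fin : (mu `[0%R, +oo[%classic < +oo)%E.

Let mu_fin_num (t : R) : mu `[0%R, t]%classic \is a fin_num.
Proof.
rewrite ge0_fin_numE//; apply: le_lt_trans mu_fin; apply: le_measure; rewrite ?inE//.
by apply: subset_itvl; rewrite bnd_simp.
Qed.

Lemma cumul_ge0 (t : R) : 0 <= cumul mu t.
Proof. exact: fine_ge0. Qed.

Lemma le_cumul_total_mass (t : R) : cumul mu t <= total_mass mu.
Proof.
apply: fine_le => //; first by rewrite ge0_fin_numE.
by apply: le_measure; rewrite ?inE//; apply: subset_itvl; rewrite bnd_simp.
Qed.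

Lemma cumul_nondecreasing : {homo cumul mu : s t / s <= t}.
Proof.
move=> s t st; apply: fine_le => //.
by apply: le_measure; rewrite ?inE//; apply: subset_itvl; rewrite bnd_simp.
Qed.

End cumulative_mass.

(** Reduction to the comparison argument: [phi] and [gamma], given on half-lines, are extended to
    monotone functions on the whole line without changing the limits and integrals involved. *)
Lemma path_limsup_le {R : realType}
    (mu : {measure set (measurableTypeR R) -> \bar R})
    (f phi dphi gamma x z : R -> R) (T0 : R) :
  (0 < mu `[0%R, +oo[%classic)%E -> (mu `[0%R, +oo[%classic < +oo)%E ->
  continuous f -> (forall y, 0 < y -> 0 < f y) ->
  C1_ge0 phi dphi -> (forall y, 0 <= y -> 0 < phi y) ->
  (forall y, 0 <= y -> 0 < dphi y) -> phi y @[y --> +oo] --> +oo ->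
  f y / phi y @[y --> +oo] --> (1 : R) ->
  `|f y| / phi `|y| @[y --> +oo] --> (1 : R) ->
  `|f y| / phi `|y| @[y --> -oo] --> (1 : R) ->
  (forall t, 0 < t -> 0 < gamma t) ->
  (forall s t, 0 < s -> s <= t -> gamma s <= gamma t) ->
  gamma t / (total_mass mu *
    \int[lebesgue_measure]_(s in `]0, t]) f (gamma s)) @[t --> +oo] --> (0 : R) ->
  cadlag x ->
  (forall t, 0 <= t -> x t = x 0
    + \int[lebesgue_measure]_(s in `[0, t]) (cumul mu (t - s) * f (x s)) + z t) ->
  (forall t, T0 <= t -> `|z t| <= 2 * gamma t) ->
  (limf_esup (fun t : R => Fext f `|x t| / (total_mass mu * t)%:E) (+oo)%R
     <= 1)%E.
Proof.
move=> mu_pos mu_fin fc fpos phi_C1 phi_pos dphi_pos phiy f_phi f_phip f_phin.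
move=> gamma_gt0 gamma_nd gammaL xcad xE zgamma.
have M0 : 0 < total_mass mu by rewrite fine_gt0// mu_pos.
pose psi (y : R) := phi (Num.max 0 y).
have psiE y : 0 <= y -> psi y = phi y by move=> y0; rewrite /psi max_r.
have psic : continuous psi by exact: (C1_ge0_max_continuous phi_C1).
have psi_pos y : 0 < psi y by rewrite phi_pos// le_max lexx.
have psi_nd : {homo psi : s t / s <= t}.
  move=> s t st; apply: (C1_ge0_nondecreasing phi_C1).
  - by move=> y y0; rewrite ltW// dphi_pos.
  - by rewrite in_itv/= andbT le_max lexx.
  - by rewrite in_itv/= andbT le_max lexx.
  - by rewrite ge_max !le_max lexx st orbT.
have psiy : psi y @[y --> +oo] --> +oo.
  apply: cvg_trans phiy; apply: near_eq_cvg; near=> y.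
  by rewrite psiE//; near: y; apply: nbhs_pinfty_ge; exact: num_real.
have f_psi : f y / psi y @[y --> +oo] --> (1 : R).
  apply: cvg_trans f_phi; apply: near_eq_cvg; near=> y.
  by rewrite psiE//; near: y; apply: nbhs_pinfty_ge; exact: num_real.
have f_le_psi e : 0 < e ->
    exists2 C, 0 <= C & forall y, `|f y| <= (1 + e) * psi `|y| + C.
  apply: norm_le_of_equiv => //.
    by under eq_fun do rewrite psiE//.
  by under eq_fun do rewrite psiE//.
have psi_le_f e : 0 < e -> \forall y \near +oo, psi y <= (1 + e) * f y.
  exact: le_of_equiv.
(* Nothing is assumed of [gamma] outside []0, +oo[]; the value 0 there keeps [g] nondecreasing and
   nonnegative. *)
pose g (s : R) := if 0 < s then gamma s else 0.
have gE s : 0 < s -> g s = gamma s by rewrite /g => ->.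
have g_ge0 s : 0 <= g s by rewrite /g; case: ifPn => // /gamma_gt0 /ltW.
have g_nd : {homo g : s t / s <= t}.
  move=> s t st; have [s0|s0] := ltP 0 s; last by rewrite {1}/g ltNge s0.
  by rewrite !gE ?(lt_le_trans s0)//; exact: gamma_nd.
have gL : g t / (total_mass mu * \int[lebesgue_measure]_(s in `]0, t]) f (g s))
    @[t --> +oo] --> (0 : R).
  apply: cvg_trans gammaL; apply: near_eq_cvg; near=> t.
  rewrite gE; last by near: t; apply: nbhs_pinfty_gt; exact: num_real.
  congr (_ / (_ * _)); apply: eq_Rintegral => s; rewrite inE/= in_itv/= => /andP[s0 _].
  by rewrite gE.
have g_small e : 0 < e -> \forall t \near +oo,
    g t <= e * \int[lebesgue_measure]_(s in `[0, t]) psi (g s).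
  apply: (le_integral_of_L0 M0 fc) => //; first exact: f_le_psi.
  by move=> s s0; rewrite gE// gamma_gt0.
have zg t : Num.max 1 T0 <= t -> `|z t| <= 2 * g t.
  rewrite ge_max => /andP[t1 /zgamma]; rewrite gE//.
  exact: lt_le_trans t1.
apply: limf_esup_le => e e0.
have H := @path_Fpos_le_linear _ _ _ f psi g x z _ M0 (cumul_ge0 mu)
  (le_cumul_total_mass mu_fin) (cumul_nondecreasing mu_fin)
  fc fpos psic psi_nd psi_pos psiy f_le_psi psi_le_f g_nd g_ge0 g_small
  xcad xE zg e e0.
near=> t.
have t0 : 0 < t by near: t; apply: nbhs_pinfty_gt; exact: num_real.
have Ht : forall y, 0 < y -> y <= `|x t| ->
  Fpos f y <= (1 + e) * (total_mass mu * t) by near: t; exact: H.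
have Mt : 0 < total_mass mu * t by rewrite mulr_gt0.
rewrite inver gt_eqF// lee_pdivrMr// -EFinM.
(* When [x t = 0], [F] at 0 is compared with [F] at 1, which is 0. *)
have [xt0|xt0] := ltP 0 `|x t|.
  by apply: le_trans (Fext_le_Fpos fc fpos _ xt0 (lexx _)) _ => //; rewrite lee_fin Ht.
apply: le_trans (Fext_le_Fpos fc fpos _ ltr01 _) _ => //.
  exact: le_trans xt0 _.
rewrite /Fpos lexx set_itv1 Rintegral_set1 lee_fin mulr_ge0// ?ltW//.
by rewrite addr_gt0.
Unshelve. all: by end_near. Qed.

(** * Growth of the stable process *)

Lemma cosB1_le {R : realType} (x : R) : 1 - cos x <= `|x|.
Proof.
rewrite -cos_norm; move: `|x| (normr_ge0 x) => {}x.
rewrite le_eqVlt => /predU1P[<-|x0]; first by rewrite cos0 subrr.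
have [c _ cE] := @MVT R (@cos R) (fun z => - sin z) 0 x x0
  (fun z _ => is_derive_cos z) (continuous_subspaceT (@continuous_cos R)).
move: cE; rewrite cos0 subr0 => /(congr1 -%R); rewrite opprB => ->.
by rewrite -mulNr opprK ler_piMl ?sin_le1// ltW.
Qed.

(** The integral equals [u - sin (u y) / y], and the second term is at most [1 / |y| <= u / 2]. *)
Lemma integral_cosB1_ge {R : realType} (u y : R) : 0 < u -> 2 <= u * `|y| ->
  ((u / 2)%:E <= \int[lebesgue_measure]_(l in `[0%R, u]) (1 - cos (l * y))%:E)%E.
Proof.
move=> u0 uy.
have y0 : y != 0.
  by apply: contraTneq uy => ->; rewrite normr0 mulr0 -ltNge ltr0n.
pose S (l : R) := l - y^-1 * sin (l * y).
have dS (l : R) : is_derive l 1 S (1 - cos (l * y)).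
  have d1 : is_derive l 1 ( *%R^~ y) y.
    have := is_deriveM (is_derive_id l 1) (is_derive_cst y l 1).
    by rewrite scaler0 add0r /GRing.scale/= mulr1.
  have d2 := is_derive1_comp (f := @sin R) (g := *%R^~ y) (is_derive_sin _) d1.
  have := is_deriveB (is_derive_id l 1) (is_deriveZ y^-1 d2).
  by rewrite /GRing.scale/= mulrCA mulVf// mulr1.
have Sc : continuous S.
  move=> l; apply: differentiable_continuous; apply/derivable1_diffP.
  by have [] := dS l.
have cc : continuous (fun l : R => 1 - cos (l * y)).
  move=> l; apply: cvgB; first exact: cvg_cst.
  by apply: continuous_comp; [apply: cvgMl; exact: cvg_id|exact: continuous_cos].
rewrite (@continuous_FTC2 _ _ S 0 u)//.
- rewrite -EFinB lee_fin /S mul0r sin0 mulr0 !subr0.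
  have : y^-1 * sin (u * y) <= `|y|^-1.
    rewrite (le_trans (ler_norm _))// normrM normfV ler_piMr//.
    exact: sin_max.
  have : `|y|^-1 <= u / 2.
    by rewrite -[leLHS]mul1r ler_pdivrMr ?normr_gt0// mulrAC ler_pdivlMr// mul1r.
  by lra.
- exact: continuous_subspaceT.
- split.
  + by move=> l _; have [] := dS l.
  + exact: cvg_at_right_filter (Sc _).
  + exact: cvg_at_left_filter (Sc _).
- by move=> l _; have [_] := dS l; rewrite derive1E.
Qed.

(* Markov's inequality for the average of [1 - cos (l Y)] over [0 <= l <= u],
   which is at least 1/2 wherever [|u Y| >= 2]. *)
Lemma tail_le_char {d : measure_display} {T : measurableType d} {R : realType}
    (P : probability T R) (Y : T -> R) (u K : R) :
  measurable_fun [set: T] Y -> 0 < u ->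
  (forall l, 0 <= l -> l <= u ->
    1 - fine ('E_P[fun w => cos (l * Y w)]) <= K) ->
  (P [set w | (2 <= u * `|Y w|)%R] <= (2 * K)%:E)%E.
Proof.
move=> mY u0 hK.
set A := [set w | _].
have mA : measurable A.
  rewrite -[A]setTI; apply: measurable_fun_le => //.
  by apply: measurable_funM => //; exact: measurableT_comp.
(* The double integral of [k] is at least [(u / 2) * P A] when integrated over [l] first, and at
   most [K * u] when integrated over [w] first; Tonelli equates the two. *)
pose k (p : R * T) : \bar R := (\1_(`[0, u]%classic) p.1 * (1 - cos (p.1 * Y p.2)))%:E.
have k0 p : (0 <= k p)%E.
  by rewrite lee_fin mulr_ge0// subr_ge0 cos_le1.
have mk : measurable_fun [set: R * T] k.
  apply/measurable_EFinP; apply: measurable_funM.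
    apply: (@measurableT_comp _ _ _ _ _ _ (\1_(`[0, u]%classic : set R) : R -> R)).
      exact: measurable_indic.
    exact: measurable_fst.
  apply: measurable_funB => //.
  apply: (@measurableT_comp _ _ _ _ _ _ (@cos R)).
    by apply: continuous_measurable_fun; exact: continuous_cos.
  apply: measurable_funM => //.
  exact: measurableT_comp.
have := @fubini_tonelli _ _ _ _ _ (@lebesgue_measure R) P k mk k0.
move=> kE.
have mcos l : measurable_fun [set: T] (fun w => cos (l * Y w)).
  apply: (@measurableT_comp _ _ _ _ _ _ (@cos R)).
    by apply: continuous_measurable_fun; exact: continuous_cos.
  exact: measurable_funM.
have icos l : P.-integrable [set: T] (EFin \o (fun w => cos (l * Y w))).
  apply: measurable_bounded_integrable => //.
    by rewrite (le_lt_trans (probability_le1 P measurableT))// ltry.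
  exists 1; split; rewrite ?num_real// => r r1 w _ /=.
  by rewrite (le_trans (cos_max _))// ltW.
have Ecos l : (\int[P]_w (1 - cos (l * Y w))%:E =
    (1 - fine ('E_P[fun w => cos (l * Y w)]))%:E)%E.
  rewrite expectation.unlock; under eq_integral do rewrite EFinB.
  rewrite integralB_EFin//; last exact: finite_measure_integrable_cst.
  rewrite integral_cst// mul1e EFinB fineK//; last exact: integrable_fin_num (icos l).
  by congr (_ - _)%E; exact: probability_setT.
have K0 : 0 <= K.
  rewrite (le_trans _ (hK 0 (lexx _) (ltW u0)))// -lee_fin -Ecos.
  by apply: integral_ge0 => w _; rewrite lee_fin subr_ge0 cos_le1.
have lo : ((u / 2)%:E * P A <= \int[P]_w \int[lebesgue_measure]_l k (l, w))%E.
  have -> : ((u / 2)%:E * P A = \int[P]_w (u / 2 * \1_A w)%:E)%E.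
    under eq_integral do rewrite EFinM.
    rewrite ge0_integralZl//; last 2 first.
      by apply/measurable_EFinP; exact: measurable_indic.
      by rewrite lee_fin divr_ge0// ltW.
    by rewrite integral_indic// setIT.
  apply: ge0_le_integral => //.
  - by move=> w _; rewrite lee_fin mulr_ge0// divr_ge0// ltW.
  - by apply/measurable_EFinP; apply: measurable_funM => //; exact: measurable_indic.
  - exact: measurable_fun_fubini_tonelli_G.
  move=> w _; rewrite indicE.
  case: (boolP (w \in A)) => [|_]; last by rewrite mulr0; exact: integral_ge0.
  rewrite inE /A/= mulr1 => /(integral_cosB1_ge u0) /le_trans; apply.
  rewrite integral_mkcond le_eqVlt; apply/orP; left; apply/eqP.
  apply: eq_integral => l _; rewrite patchE /k indicE /=.
  by case: ifPn => _; rewrite ?mul1r ?mul0r.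
have hi : (\int[lebesgue_measure]_l \int[P]_w k (l, w) <= (K * u)%:E)%E.
  have -> : ((K * u)%:E = \int[lebesgue_measure]_l (K * \1_(`[0%R, u]%classic) l)%:E)%E.
    under eq_integral do rewrite EFinM.
    rewrite ge0_integralZl//; last first.
      by apply/measurable_EFinP; exact: measurable_indic.
    rewrite integral_indic// setIT/= lebesgue_measure_itv/= lte_fin u0.
    by rewrite EFinM sube0.
  apply: ge0_le_integral => //.
  - by move=> l _; exact: integral_ge0.
  - exact: measurable_fun_fubini_tonelli_F.
  - by apply/measurable_EFinP; apply: measurable_funM => //; exact: measurable_indic.
  move=> l _; rewrite /k/= indicE.
  case: (boolP (l \in `[0, u]%classic)) => [|_]; last first.
    by under eq_integral do rewrite mul0r; rewrite integral0 mulr0.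
  rewrite inE/= in_itv/= => /andP[l0 lu].
  under eq_integral do rewrite mul1r.
  by rewrite Ecos mulr1 lee_fin hK.
rewrite kE in hi.
have := le_trans lo hi.
have -> : (K * u)%:E = ((u / 2)%:E * (2 * K)%:E)%E.
  by rewrite -EFinM; congr EFin; field.
by rewrite lee_pmul2l// lte_fin divr_gt0.
Qed.

(** Applied to the real and imaginary parts of a characteristic function, this forces the real part
    of the exponent to be nonnegative. *)
Lemma normr_fine_expectation_le1 {d : measure_display} {T : measurableType d}
    {R : realType} (P : probability T R) (Y : T -> R) :
  measurable_fun [set: T] Y -> (forall w, `|Y w| <= 1) ->
  `|fine ('E_P[Y])| <= 1.
Proof.
move=> mY Y1.
have i1 : P.-integrable [set: T] (EFin \o cst 1).
  exact: finite_measure_integrable_cst.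
have iY : P.-integrable [set: T] (EFin \o Y).
  apply: le_integrable i1 => //; first exact/measurable_EFinP.
  by move=> w _ /=; rewrite lee_fin normr1.
rewrite expectation.unlock -[X in X <= _]/(`|\int[P]_w Y w|).
apply: le_trans (le_normr_Rintegral _ iY) _ => //.
have -> : 1 = \int[P]_w (cst 1 w) :> R.
  rewrite Rintegral_cst// mul1r.
  by rewrite -[LHS]/(fine 1%E); congr fine; exact/esym/probability_setT.
by apply: le_Rintegral => //; exact: integrable_norm.
Qed.

(** * Power tail at a fixed time *)

Section stable_tail.
Context {d : measure_display} {T : measurableType d} {R : realType}.
Variables (P : probability T R) (Z : R -> T -> R) (alpha : R) (Psi : R -> R[i]).
Hypotheses (alpha0 : 0 < alpha)
  (mZ : forall t, 0 <= t -> measurable_fun [set: T] (Z t))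
  (ZPsi : char_exponent P Z Psi)
  (Psi_hom : forall k l, 0 < k -> Psi (k * l) = (k `^ alpha)%:C%C * Psi l).

(** Write [Psi 1 = a + i b] and [s = t l^alpha]. By homogeneity the characteristic function of [Z t]
    at [l > 0] has real part [exp (- s a) cos (s b)], and one minus this is at most [s (a + |b|)].
    The tail bound is then used with [u = 2 / x]. *)
Lemma stable_tail : exists2 C, 0 <= C & forall t x, 0 <= t -> 0 < x ->
  (P [set w | (x <= `|Z t w|)%R] <= (C * t * x `^ (- alpha))%:E)%E.
Proof.
case PsiE : (Psi 1) => [a b].
have charE t l : 0 <= t -> 0 < l ->
    fine ('E_P[fun w => cos (l * Z t w)]) =
      expR (- (t * l `^ alpha * a)) * cos (- (t * l `^ alpha * b)) /\
    fine ('E_P[fun w => sin (l * Z t w)]) =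
      expR (- (t * l `^ alpha * a)) * sin (- (t * l `^ alpha * b)).
  move=> t0 l0; have := ZPsi l t0.
  rewrite -[in Psi l](mulr1 l) Psi_hom// PsiE /char_fun /cexp.
  simpc => /= -[-> ->].
  by rewrite !mulrA.
have mcos t l : 0 <= t -> measurable_fun [set: T] (fun w => cos (l * Z t w)).
  move=> t0; apply: (@measurableT_comp _ _ _ _ _ _ (@cos R)).
    by apply: continuous_measurable_fun; exact: continuous_cos.
  by apply: measurable_funM => //; exact: mZ.
have msin t l : 0 <= t -> measurable_fun [set: T] (fun w => sin (l * Z t w)).
  move=> t0; apply: (@measurableT_comp _ _ _ _ _ _ (@sin R)).
    by apply: continuous_measurable_fun; exact: continuous_sin.
  by apply: measurable_funM => //; exact: mZ.
(* If [a < 0], at time [-1 / a] and [l = 1] the characteristic function has modulus [e >= 2], while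
   its two parts are bounded by 1, so that [4 <= e^2 <= 2]. *)
have a0 : 0 <= a.
  rewrite leNgt; apply/negP => a_lt0.
  have s0 : 0 <= - a^-1 by rewrite oppr_ge0 invr_le0 ltW.
  have [cE sE] := charE _ _ s0 ltr01.
  have c1 := normr_fine_expectation_le1 P (mcos _ 1 s0) (fun w => cos_max _).
  have s1 := normr_fine_expectation_le1 P (msin _ 1 s0) (fun w => sin_max _).
  rewrite cE in c1; rewrite sE in s1.
  move: c1 s1; rewrite powR1 mulr1 mulNr mulVf ?lt_eqF// opprK.
  set th := - _; set ee := expR 1 => c1 s1.
  have e2 : 2 <= ee by have := expR_ge1Dx (1 : R); rewrite -[1 + 1]/(2%:R).
  have : (ee * cos th) ^+ 2 + (ee * sin th) ^+ 2 = ee ^+ 2.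
    by rewrite !exprMn -mulrDr cos2Dsin2 mulr1.
  have : (ee * cos th) ^+ 2 <= 1 by rewrite -real_normK ?num_real// expr_le1.
  have : (ee * sin th) ^+ 2 <= 1 by rewrite -real_normK ?num_real// expr_le1.
  by nra.
pose c := a + `|b|.
have c0 : 0 <= c by rewrite addr_ge0.
exists (2 * 2 `^ alpha * c).
  by rewrite mulr_ge0// mulr_ge0// powR_ge0.
move=> t x t0 x0.
have u0 : 0 < 2 / x by rewrite divr_gt0.
have := @tail_le_char _ _ _ P (Z t) (2 / x) (t * (2 / x) `^ alpha * c) (mZ t0) u0.
have -> : [set w | 2 <= 2 / x * `|Z t w|] = [set w | x <= `|Z t w|].
  apply/seteqP; split => w /=; rewrite mulrAC ler_pdivlMr// ler_pM2l//.
have -> : 2 * (t * (2 / x) `^ alpha * c) = 2 * 2 `^ alpha * c * t * x `^ (- alpha).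
  rewrite powRM ?invr_ge0 ?(ltW x0)// -powR_inv1 ?(ltW x0)// -powRrM mulN1r.
  by ring.
(* Homogeneity is available for positive factors only, so [l = 0] is handled directly. *)
apply=> l; rewrite le_eqVlt => /predU1P[<- _|l0 lu].
  under eq_fun do rewrite mul0r cos0.
  by rewrite expectation_cst/= subrr !mulr_ge0// powR_ge0.
have [-> _] := charE t l t0 l0.
set s := t * l `^ alpha.
have s0 : 0 <= s by rewrite mulr_ge0// powR_ge0.
(* Split [1 - E cos = (1 - E) + E (1 - cos)] with [E = exp (- s a) <= 1]: the first term is at most
   [s a], the second at most [s |b|]. *)
apply: (@le_trans _ _ (s * c)).
  have e1 : expR (- (s * a)) <= 1 by rewrite -expR0 ler_expR oppr_le0 mulr_ge0.
  have e2 : 1 - s * a <= expR (- (s * a)) by exact: expR_ge1Dx.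
  have c1 : 1 - cos (- (s * b)) <= s * `|b|.
    by rewrite (le_trans (cosB1_le _))// normrN normrM ger0_norm.
  have c2 : 0 <= 1 - cos (- (s * b)) by rewrite subr_ge0 cos_le1.
  have : expR (- (s * a)) * (1 - cos (- (s * b))) <= 1 - cos (- (s * b)).
    by rewrite ler_piMl.
  by rewrite /c; lra.
rewrite ler_wpM2r// ler_wpM2l//.
by apply: ge0_ler_powR => //; rewrite ?nnegrE; exact: ltW.
Qed.

End stable_tail.

(** * Tail of the running supremum *)

Section maximal_inequality.
Context {d : measure_display} {T : measurableType d} {R : realType}.
Variables (P : probability T R) (F : R -> set (set T)) (Z : R -> T -> R).
Variables (alpha C : R).
Hypotheses (hF : usual_filtration P F) (hZ : levy_process P F Z) (C0 : 0 <= C)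
  (tail : forall t x, 0 <= t -> 0 < x ->
    (P [set w | (x <= `|Z t w|)%R] <= (C * t * x `^ (- alpha))%:E)%E).

Lemma levy_measurable t : 0 <= t -> measurable_fun [set: T] (Z t).
Proof.
move=> t0 _ B mB; rewrite setTI.
by apply: (filtration_sub hF t0); exact: (levy_adapted hZ).
Qed.

Let measurable_norm_ge (x : R) : measurable [set y : R | x <= `|y|].
Proof.
have -> : [set y : R | x <= `|y|] = [set: R] `&` [set y | x <= `|y|] by rewrite setTI.
by apply: measurable_fun_le => //; exact: measurable_normr.
Qed.

Local Notation q t x := (C * t * x `^ (- alpha)).

Let increment_tail s t x : 0 <= s -> s <= t -> 0 < x ->
  (P [set w | (x <= `|Z t w - Z s w|)%R] <= (q t x)%:E)%E.
Proof.
move=> s0 st x0.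
have := levy_stationary hZ s0 st (measurable_norm_ge x).
rewrite /preimage /= => ->.
have ts : 0 <= t - s by rewrite subr_ge0.
apply: le_trans (tail ts x0) _; rewrite lee_fin ler_wpM2r ?powR_ge0//.
by rewrite ler_wpM2l// gerBl.
Qed.

(* Let [k] be the first index with [|Z (s k)| >= 2 x].  Either [|Z t| >= x], or the
   increment [Z t - Z (s k)], independent of the passage at [k], is at least [x]. *)
Lemma levy_maximal (s : nat -> R) (t x : R) :
  (forall k, 0 <= s k) -> {homo s : i j / (i <= j)%N >-> i <= j} ->
  (forall k, s k <= t) -> 0 < x ->
  (P (\bigcup_k [set w | (2 * x <= `|Z (s k) w|)%R]) <= (2 * q t x)%:E)%E.
Proof.
move=> s0 s_nd st x0.
have t0 : 0 <= t by exact: le_trans (st 0%N).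
pose A k := [set w | 2 * x <= `|Z (s k) w|].
pose D k := [set w | x <= `|Z t w - Z (s k) w|].
have FA j k : (j <= k)%N -> F (s k) (A j).
  move=> jk; apply: (filtration_mono hF (s0 j) (s_nd _ _ jk)).
  exact: (levy_adapted hZ (s0 j) (measurable_norm_ge (2 * x))).
(* [seqDU A k] is the event that the first passage is at index [k]. It depends only on times up to
   [s k], so the increment after [s k] is independent of it. *)
have FB k : F (s k) (seqDU A k).
  have sF := sigma_algebra_id (filtration_sigma hF (s0 k)).
  have mA j : (j <= k)%N -> measurable (A j : set (g_sigma_algebraType (F (s k)))).
    by move=> jk; rewrite /measurable/= sF; exact: FA.
  have : measurable (seqDU A k : set (g_sigma_algebraType (F (s k)))).
    apply: measurableD; first exact: mA.
    apply: bigsetU_measurable => j _; apply: mA; exact: ltnW.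
  by rewrite /measurable/= sF.
have mB k : measurable (seqDU A k) by exact: (filtration_sub hF (s0 k)).
have mD k : measurable (D k).
  rewrite -[D k]setTI; apply: measurable_fun_le => //.
  apply: measurableT_comp => //; apply: measurable_funB; exact: levy_measurable.
have mA0 : measurable [set w | x <= `|Z t w|].
  rewrite -[X in measurable X]setTI; apply: measurable_fun_le => //.
  by apply: measurableT_comp => //; exact: levy_measurable.
have sub : \bigcup_k A k `<=` [set w | x <= `|Z t w|] `|` \bigcup_k (seqDU A k `&` D k).
  rewrite seqDU_bigcup_eq => w [k _ Bw].
  have [xZ|Zx] := leP x `|Z t w|; first by left.
  right; exists k => //; split => //; rewrite /D/=.
  have : 2 * x <= `|Z (s k) w| by exact: subset_seqDU Bw.
  have := ler_normD (Z t w) (Z (s k) w - Z t w).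
  rewrite addrC subrK distrC.
  by lra.
have PBD k : (P (seqDU A k `&` D k) <= (q t x)%:E * P (seqDU A k))%E.
  have := levy_independent hZ (s0 k) (st k) (FB k) (measurable_norm_ge x).
  rewrite -/(D k) => ->.
  by rewrite muleC lee_wpmul2r// increment_tail.
have mU : measurable (\bigcup_k (seqDU A k `&` D k)).
  by apply: bigcup_measurable => k _; exact: measurableI.
apply: (@le_trans _ _ (P ([set w | x <= `|Z t w|] `|` \bigcup_k (seqDU A k `&` D k)))).
  apply: le_measure; rewrite ?inE//.
    rewrite -/A seqDU_bigcup_eq; exact: bigcup_measurable.
  exact: measurableU.
apply: le_trans (measureU2 _ _ _) _ => //.
(* One [q t x] pays for [|Z t| >= x]. The other multiplies the sum of the probabilities of the
   disjoint passage events, which is at most 1. *)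
rewrite mulr2n mulrDl !mul1r EFinD; apply: leeD; first exact: tail.
have tB := @trivIset_seqDU _ A.
apply: (@le_trans _ _ (\sum_(k <oo) ((q t x)%:E * P (seqDU A k)))%E).
  apply: (@le_trans _ _ (\sum_(k <oo) P (seqDU A k `&` D k))%E).
    by apply: measure_sigma_subadditive => // k; exact: measurableI.
  exact: lee_nneseries.
have q0 : 0 <= q t x by rewrite !mulr_ge0// powR_ge0.
have mUB : measurable (\bigcup_k seqDU A k) by exact: bigcup_measurable.
rewrite nneseriesZl// -[leRHS]mule1 lee_wpmul2l ?lee_fin//.
apply: le_trans (probability_le1 P mUB).
by rewrite le_eqVlt measure_semi_bigcup ?eqxx.
Qed.

(* [D] is a countable union over dyadic times, hence measurable; right
   continuity covers the other times. *)
Lemma levy_sup (t x : R) : 0 < t -> 0 < x ->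
  exists D : set T, [/\ measurable D, (P D <= (2 * q t x)%:E)%E &
    forall w, cadlag (Z ^~ w) -> ~ D w ->
      forall s, 0 <= s -> s < t -> `|Z s w| <= 2 * x].
Proof.
move=> t0 x0.
pose c n : R := t / (2 ^ n)%:R.
have c0 n : 0 < c n by rewrite divr_gt0// ltr0n expn_gt0.
(* Capping the index makes the grid an infinite nondecreasing sequence that stays at most [t], as
   the maximal inequality requires. *)
pose grid n k : R := c n * (minn k (2 ^ n))%:R.
have grid_ge0 n k : 0 <= grid n k by rewrite mulr_ge0// ltW.
pose G n := \bigcup_k [set w | 2 * x <= `|Z (grid n k) w|].
have mG n : measurable (G n).
  apply: bigcup_measurable => k _.
  rewrite -[X in measurable X]setTI; apply: measurable_fun_le => //.
  by apply: measurableT_comp => //; exact: levy_measurable.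
have mGU : measurable (\bigcup_n G n) by exact: bigcup_measurable.
(* Successive dyadic grids are nested, so the events increase and the uniform bound passes to their
   union by continuity from below. *)
have GS n : G n `<=` G n.+1.
  move=> w [k _ Zw]; exists (2 * k)%N => //; rewrite /=.
  suff -> : grid n.+1 (2 * k)%N = grid n k by [].
  rewrite /grid /c expnS -minnMr !natrM; field.
  by rewrite pnatr_eq0 expn_eq0.
have PG n : (P (G n) <= (2 * q t x)%:E)%E.
  apply: levy_maximal => // [i j ij|k].
    rewrite ler_wpM2l ?(ltW (c0 n))// ler_nat.
    by rewrite leq_min geq_minr andbT (leq_trans (geq_minl _ _)).
  rewrite /grid /c mulrAC ler_pdivrMr ?ltr0n ?expn_gt0//.
  by rewrite ler_wpM2l ?(ltW t0)// ler_nat geq_minr.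
exists (\bigcup_n G n); split => //.
  have nd : nondecreasing_seq G.
    by apply/nondecreasing_seqP => n; apply/subsetPset; exact: GS.
  have cG := nondecreasing_cvg_mu (mu := P) mG mGU nd.
  rewrite -(cvg_lim _ cG)//; apply: lime_le.
    by apply/cvg_ex; eexists; exact: cG.
  exact: nearW.
move=> w [Zr _] nD s s0 st.
pose u n := c n * (Num.trunc (s / c n)).+1%:R.
(* The cap is inactive: [s < t] gives [s / c n < 2 ^ n], so the successor of its integer part is at
   most [2 ^ n]. *)
have uE n : u n = grid n (Num.trunc (s / c n)).+1.
  rewrite /u /grid; congr (_ * _%:R); apply/esym/minn_idPl.
  have /truncn_itv /andP[ls _] : 0 <= s / c n by rewrite divr_ge0// ltW.
  rewrite -(@ltr_nat R); apply: le_lt_trans ls _.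
  rewrite ltr_pdivrMr// /c mulrC divfK ?pnatr_eq0 ?expn_eq0//.
have us n : s < u n /\ u n <= s + c n by apply/andP; exact: truncn_mesh.
have u_cvg : u n @[n --> \oo] --> s.
  apply: (@squeeze_cvgr _ _ _ _ (fun=> s) (fun n => s + c n)).
  - by near=> n; have [/ltW -> ->] := us n.
  - exact: cvg_cst.
  rewrite -[X in _ --> X]addr0; apply: cvgD; first exact: cvg_cst.
  have -> : c = geometric t 2^-1.
    by apply/funext => n; rewrite /c /geometric/= natrX exprVn.
  apply: cvg_geometric; rewrite ger0_norm ?invr_ge0//.
  by rewrite invf_lt1 ?ltr1n.
have Zu : `|Z (u n) w| @[n --> \oo] --> `|Z s w|.
  apply: cvg_norm; have /cvg_at_rightP := Zr s s0; apply; split => // n.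
  by have [] := us n.
rewrite -(cvg_lim _ Zu)//; apply: limr_le; first by apply/cvg_ex; eexists; exact: Zu.
apply: nearW => n; rewrite leNgt; apply/negP => Zx; apply: nD.
by exists n => //; exists (Num.trunc (s / c n)).+1 => //=; rewrite -uE ltW.
Unshelve. all: by end_near. Qed.

End maximal_inequality.

(** Borel-Cantelli over dyadic blocks: since [gamma] is nondecreasing, each exceptional probability
    is dominated by the integral of [gamma^(- alpha)] over its own block, and the blocks are
    disjoint. *)
Lemma levy_eventually_le {d : measure_display} {T : measurableType d}
    {R : realType} (P : probability T R) (F : R -> set (set T))
    (Z : R -> T -> R) (alpha C : R) (gamma : R -> R) :
  usual_filtration P F -> levy_process P F Z -> 0 <= C -> 0 < alpha ->
  (forall t x, 0 <= t -> 0 < x ->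
    (P [set w | (x <= `|Z t w|)%R] <= (C * t * x `^ (- alpha))%:E)%E) ->
  {within `]0, +oo[, continuous gamma} ->
  (forall t, 0 < t -> 0 < gamma t) ->
  (forall s t, 0 < s -> s <= t -> gamma s <= gamma t) ->
  (\int[lebesgue_measure]_(s in `]0%R, +oo[) (gamma s `^ (- alpha))%:E < +oo)%E ->
  {ae P, forall w, exists T0, forall t, T0 <= t -> `|Z t w| <= 2 * gamma t}.
Proof.
move=> hF hZ C0 alpha0 tail gamma_cont gamma_gt0 gamma_nd gamma_int.
pose p n : R := (2 ^ n)%:R.
have p0 n : 0 < p n by rewrite ltr0n expn_gt0.
have pS n : p n.+1 = 2 * p n by rewrite /p expnS natrM.
(* [E n] is the exceptional event for the horizon [2^(n+2)] and the level [gamma (2^(n+1))]. *)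
have [E EP] := choice (fun n =>
  levy_sup hF hZ C0 tail (p0 n.+2) (gamma_gt0 _ (p0 n.+1))).
pose h s := (gamma s `^ (- alpha))%:E.
pose I n := `]p n, p n.+1]%classic.
have mI n : measurable (I n) by exact: measurable_itv.
have I0 n : I n `<=` `]0, +oo[.
  by move=> s; rewrite /I/= !in_itv/= andbT => /andP[+ _]; exact: lt_trans.
have mh : measurable_fun (`]0, +oo[%classic : set R) h.
  apply/measurable_EFinP; apply: (measurableT_comp (measurable_powR _)).
  exact: subspace_continuous_measurable_fun.
have h0 s : (0 <= h s)%E by rewrite lee_fin powR_ge0.
(* The factor 8 is the 2 of the maximal inequality times 4, as the horizon [p n.+2] is four times
   the length [p n] of [I n]. On [I n], [gamma^(- alpha)] is at least its value at the right end. *)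
have PE n : (P (E n) <= (8 * C)%:E * \int[lebesgue_measure]_(s in I n) h s)%E.
  have [_ + _] := EP n; move/le_trans; apply.
  set x := gamma _ `^ _.
  have -> : (2 * (C * p n.+2 * x))%:E =
      ((8 * C)%:E * \int[lebesgue_measure]_(s in I n) x%:E)%E.
    rewrite /I integral_cst//= lebesgue_measure_itv/= lte_fin.
    by rewrite !pS ltr_pMl// ltr1n -EFinB -!EFinM; congr EFin; ring.
  apply: lee_wpmul2l; first by rewrite lee_fin mulr_ge0.
  apply: ge0_le_integral => //.
  - exact: mI.
  - by move=> s _; rewrite lee_fin powR_ge0.
  - exact: measurable_funS mh.
  move=> s; rewrite /I/= in_itv/= => /andP[ps sp]; rewrite lee_fin.
  have s0 : 0 < s by exact: lt_trans ps.
  rewrite /x !powRN lef_pV2 ?posrE ?powR_gt0 ?gamma_gt0//.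
  apply: ge0_ler_powR; rewrite ?nnegrE; first exact: ltW.
  - exact/ltW/gamma_gt0.
  - exact/ltW/gamma_gt0.
  - exact: gamma_nd.
have tI : trivIset setT I.
  apply/trivIsetP => i j _ _; wlog ij : i j / (i < j)%N.
    by move=> H; rewrite neq_ltn => /orP[] ij; [|rewrite setIC]; apply: H => //; rewrite lt_eqF.
  move=> _; apply/seteqP; split => // s [].
  rewrite /I/= !in_itv/= => /andP[_ si] /andP[sj _].
  have := lt_le_trans sj si; rewrite ltr_nat ltn_exp2l//.
  by rewrite ltnS leqNgt ij.
have mE n : measurable (E n) by have [] := EP n.
have sumE : (\sum_(0 <= n <oo) P (E n) < +oo)%E.
  apply: (@le_lt_trans _ _ (\sum_(0 <= n <oo)
      ((8 * C)%:E * \int[lebesgue_measure]_(s in I n) h s))%E).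
    exact: lee_nneseries.
  rewrite nneseriesZl; last by move=> n _; exact: integral_ge0.
  apply: lte_mul_pinfty; rewrite ?lee_fin ?mulr_ge0//.
  apply: le_lt_trans gamma_int.
  have sub : \bigcup_n I n `<=` `]0, +oo[ by move=> s [n _]; exact: I0.
  have mU : measurable (\bigcup_n I n) by exact: bigcup_measurable.
  rewrite -ge0_integral_bigcup//; last exact: measurable_funS mh.
  exact: ge0_subset_integral.
have limE : P.-negligible (lim_sup_set E).
  apply/negligibleP; last exact: lim_sup_set_cvg0.
  by apply: bigcapT_measurable => n; exact: bigcup_measurable.
have nE : {ae P, forall w, ~ lim_sup_set E w}.
  by apply: negligibleS limE => w /=; exact: contrapT.
apply: filterS2 (levy_cadlag hZ) nE => w cw nw.
have [N hN] : exists N, forall n, (N <= n)%N -> ~ E n w.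
  apply: contrapT => H; apply: nw => N _.
  apply: contrapT => HN; apply: H; exists N => n Nn En.
  by apply: HN; exists n.
exists (p N.+1) => t pt.
have t0 : 0 <= t by rewrite (le_trans _ pt)// ltW.
(* Here [n.+1] is the binary logarithm of the integer part of [t]. On this block the level
   [2 * gamma (p n.+1)] is at most [2 * gamma t]. *)
have [n Nn /andP[nt tn]] : exists2 n, (N <= n)%N & p n.+1 <= t < p n.+2.
  have /truncn_itv /andP[mt tm] := t0; set m := Num.trunc t in mt tm.
  have Nm : (2 ^ N.+1 <= m)%N.
    by rewrite -ltnS -(@ltr_nat R); exact: le_lt_trans tm.
  have m0 : (0 < m)%N by rewrite (leq_trans _ Nm)// expn_gt0.
  have /andP[lm ml] := trunc_log_bounds (ltnSn 1) m0.
  set l := trunc_log 2 m in lm ml.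
  have Nl : (N < l)%N.
    by rewrite -ltnS -(ltn_exp2l _ _ (ltnSn 1)) (leq_ltn_trans Nm).
  exists l.-1; first by rewrite -ltnS prednK// (leq_ltn_trans _ Nl).
  rewrite prednK ?(leq_ltn_trans _ Nl)//; apply/andP; split.
    by apply: le_trans mt; rewrite ler_nat.
  by apply: lt_le_trans tm _; rewrite ler_nat.
have [_ _ /(_ w cw (hN n Nn) t t0 tn)] := EP n.
by move/le_trans; apply; rewrite ler_wpM2l// gamma_nd.
Qed.
Unset Implicit Arguments.

Theorem theorem3p12 (R : realType) (d : measure_display) (T : measurableType d)
    (P : probability T R) (F : R -> set (set T))
    (hF : usual_filtration P F)
    (mu : {measure set (measurableTypeR R) -> \bar R})
    (hmu_neg : mu `]-oo, 0[%classic = 0%E)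
    (hmu_pos : (0 < mu `[0%R, +oo[%classic)%E)
    (hmu_fin : (mu `[0%R, +oo[%classic < +oo)%E)
    (alpha : R) (halpha0 : 0 < alpha) (halpha2 : alpha < 2)
    (Z : R -> T -> R)
    (hZ : levy_process P F Z)
    (hZstable : stable_process P alpha Z)
    (hZdrift : ~ pure_drift P Z)
    (f : R -> R)
    (hf_lip : [locally [lipschitz f x | x in [set: R]]])
    (hf_pos : forall x : R, 0 < x -> 0 < f x)
    (hf_lim : f x @[x --> +oo] --> +oo)
    (phi dphi : R -> R)
    (hphi_C1 : C1_ge0 phi dphi)
    (hphi_pos : forall x : R, 0 <= x -> 0 < phi x)
    (hdphi_pos : forall x : R, 0 <= x -> 0 < dphi x)
    (hphi_lim : phi x @[x --> +oo] --> +oo)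
    (hdphi_lim : dphi x @[x --> +oo] --> (0 : R))
    (hf_phi : f x / phi x @[x --> +oo] --> (1 : R))
    (hf_phi_abs_p : `|f x| / phi `|x| @[x --> +oo] --> (1 : R))
    (hf_phi_abs_n : `|f x| / phi `|x| @[x --> -oo] --> (1 : R))
    (X : R -> T -> R)
    (hX : strong_solution P F mu f Z X)
    (gamma : R -> R)
    (hgamma_cont : {within `]0, +oo[, continuous gamma})
    (hgamma_pos : forall t : R, 0 < t -> 0 < gamma t)
    (hgamma_incr : forall s t : R, 0 < s -> s <= t -> gamma s <= gamma t)
    (hgamma_L : gamma t / (total_mass mu *
        \int[lebesgue_measure]_(s in `]0, t]) f (gamma s))
        @[t --> +oo] --> (0 : R))
    (hgamma_int : (\int[lebesgue_measure]_(s in `]0%R, +oo[)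
        (gamma s `^ (- alpha))%:E < +oo)%E) :
  {ae P, forall w,
    (limf_esup (fun t : R => Fext f `|X t w| / (total_mass mu * t)%:E) (+oo)%R
       <= 1)%E}.
Proof.
have fc := locally_lipschitz_continuous hf_lip.
have [Psi ZPsi Psi_hom] := hZstable.
have [C C0 tail] := stable_tail halpha0
  (fun t t0 => levy_measurable hF hZ t0) ZPsi (fun k l k0 => Psi_hom k l k0).
have Zgamma := levy_eventually_le hF hZ C0 halpha0 tail hgamma_cont hgamma_pos
  hgamma_incr hgamma_int.
(* Off three null sets everything that remains is deterministic; only [T0] depends on the path. *)
apply: filterS3 (solution_cadlag hX) (solution_eq hX) Zgamma => w xcad xE [T0 ZT0].
exact: (path_limsup_le hmu_pos hmu_fin fc hf_pos hphi_C1 hphi_pos hdphi_pos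
  hphi_lim hf_phi hf_phi_abs_p hf_phi_abs_n hgamma_pos hgamma_incr hgamma_L
  xcad xE ZT0).
Qed.
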